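(* Let $p\ge 1$, let $\Psi$ be a positive definite $p\times p$ matrix, let $m\ge p$ be real and let $q\in\{1,2,3,\ldots\}$. Then the integral $$c_{m,q}=\int_{\mathcal P_p}\exp\Big(-\tfrac12\operatorname{tr}(B^{-q})\Big)\,|B|^{-qm/2-p/2-1/2}\,dB$$ is finite (and positive), and consequently the function $$B\mapsto \mathcal W^{-q}(B\mid\Psi,m)=\frac{1}{c_{m,q}}\exp\Big(-\tfrac12\operatorname{tr}\big((\Psi^{-1/2}B\Psi^{-1/2})^{-q}\big)\Big)\frac{|\Psi|^{qm/2}}{|B|^{qm/2+p/2+1/2}}$$ is a probability density on $\mathcal P_p$.
   Context: $\mathcal P_p$ denotes the set of (symmetric) positive definite $p\times p$ real matrices, and $dB$ denotes Lebesgue measure on the $p(p+1)/2$ functionally independent entries $(B_{ij})_{i\le j}$ of a symmetric matrix. $|B|$ is the determinant. For a positive definite matrix $C$, $C^{1/2}$ denotes its unique positive definite square root, $C^{-1/2}=(C^{1/2})^{-1}$, and $C^{-q}=(C^{-1})^q$. The distribution with this density is called the power inverse Wishart distribution with parameters $(\Psi,m,q)$; for $q=1$ it is the usual inverse Wishart distribution. *)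

(* Defs.v *)
From HB Require Import structures.
From mathcomp Require Import all_boot all_order all_algebra.
From mathcomp Require Import all_classical all_reals all_analysis.
Set Implicit Arguments. Unset Strict Implicit. Unset Printing Implicit Defensive.
Import Order.TTheory GRing.Theory Num.Theory.
Local Open Scope ring_scope.
Local Open Scope classical_set_scope.

Section PowerInverseWishart.
Variable R : realType.
Variable p : nat.

Definition posdef (B : 'M[R]_p) : Prop :=
  B^T = B /\ forall v : 'cV[R]_p, v != 0 -> 0 < (v^T *m B *m v) 0 0.

Definition mxpow (A : 'M[R]_p) (q : nat) : 'M[R]_p := iter q (mulmx A) 1%:M.

(* C^{1/2}: the positive definite square root of C (unique for C p.d.). *)
Definition mx_sqrt (C : 'M[R]_p) : 'M[R]_p :=
  xget 0 [set S | posdef S /\ S *m S = C].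

Definition mx_isqrt (C : 'M[R]_p) : 'M[R]_p := invmx (mx_sqrt C).

Definition sym_pairs : seq ('I_p * 'I_p) :=
  [seq ij : 'I_p * 'I_p <- [seq (i, j) | i <- enum 'I_p, j <- enum 'I_p] | (nat_of_ord ij.1 <= nat_of_ord ij.2)%N].

Definition sym_upd (env : 'I_p -> 'I_p -> R) (ij : 'I_p * 'I_p) (x : R) :
  'I_p -> 'I_p -> R :=
  fun a b => if ((a == ij.1) && (b == ij.2)) || ((a == ij.2) && (b == ij.1))
             then x else env a b.

Fixpoint iter_int (s : seq ('I_p * 'I_p))
    (F : ('I_p -> 'I_p -> R) -> \bar R) (env : 'I_p -> 'I_p -> R) : \bar R :=
  match s with
  | [::] => F env
  | ij :: s' => (\int[lebesgue_measure]_(x in setT) iter_int s' F (sym_upd env ij x))%E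
  end.

(* Integral of a nonnegative function of a symmetric matrix w.r.t. dB,
   Lebesgue measure on the entries (B_ij)_{i<=j}. *)
Definition sym_integral (F : 'M[R]_p -> \bar R) : \bar R :=
  iter_int sym_pairs (fun env => F (\matrix_(i, j) env i j)) (fun _ _ => 0).

Definition c_const (m : R) (q : nat) : \bar R :=
  sym_integral (fun B =>
    if `[< posdef B >] then
      (expR (- (1/2) * \tr (mxpow (invmx B) q))
       * powR (\det B) (- (q%:R * m / 2) - p%:R / 2 - 1 / 2))%:E
    else 0%E).

Definition piw_density (Psi : 'M[R]_p) (m : R) (q : nat) (B : 'M[R]_p) : R :=
  (fine (c_const m q))^-1
  * expR (- (1/2) * \tr (mxpow (invmx (mx_isqrt Psi *m B *m mx_isqrt Psi)) q))
  * powR (\det Psi) (q%:R * m / 2)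
  / powR (\det B) (q%:R * m / 2 + p%:R / 2 + 1 / 2).

End PowerInverseWishart.

(* Main.v *)
Require Import Defs.
From HB Require Import structures.
From mathcomp Require Import all_boot all_order all_algebra.
From mathcomp Require Import all_classical all_reals all_analysis.
From mathcomp Require Import complex.
From mathcomp Require Import measurable_realfun zify ring lra.
Set Implicit Arguments. Unset Strict Implicit. Unset Printing Implicit Defensive.
Import Order.TTheory GRing.Theory Num.Theory.
Import numFieldNormedType.Exports.
Local Open Scope ring_scope.
Local Open Scope classical_set_scope.

(** With [a = qm/2 + (p+1)/2], diagonalizing [B] bounds the integrand of
    [c_{m,q}] by a multiple of [det(1 + B)^(-a)], and [a >= p + 1/2] because
    [m >= p] and [q >= 1].  Finiteness of the integral of [det(1 + B)^(-a)] over
    the cone then follows by induction on [p].  Write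
    [B = [[b, u^T], [u, S + u u^T / b]]], so that [B > 0] iff [b > 0] and [S > 0],
    and [det(1 + B) = (1 + b) det(1 + S + u u^T / (b (1 + b)))].  With
    [1 + S = L L^T], the substitution [u = (b (1 + b))^(1/2) L w] turns the second
    factor into [det(1 + S) (1 + |w|^2)]; integrating out [w] costs half a power
    of [det(1 + S)], which leaves the same integral for [p - 1] and [a - 1/2]
    times an integral in [b] dominated by that of [(1 + b)^(-3/2)].

    For the density, [tr((Psi^(-1/2) B Psi^(-1/2))^(-q))] depends on [Psi] only
    through [B^(-1) Psi], so the square root may be replaced by a Cholesky factor
    [L].  The congruence [B |-> L^(-1) B L^(-T)] is triangular in the entries of
    [B], with diagonal coefficients [M_ii M_jj] where [M = L^(-1)]; hence its
    Jacobian is [det(M)^(p+1)], and iterated integrals suffice. *)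

(** * Positive definite matrices *)

Section PosDef.
Variable R : realType.

Lemma sqnormE n (v : 'cV[R]_n) : (v^T *m v) 0 0 = \sum_i v i 0 ^+ 2.
Proof. by rewrite mxE; apply: eq_bigr => i _; rewrite mxE expr2. Qed.

Lemma sqnorm_ge0 n (v : 'cV[R]_n) : 0 <= (v^T *m v) 0 0.
Proof. by rewrite sqnormE sumr_ge0// => i _; exact: sqr_ge0. Qed.

Lemma sqnorm_gt0 n (v : 'cV[R]_n) : v != 0 -> 0 < (v^T *m v) 0 0.
Proof.
move=> v0; rewrite lt_neqAle sqnorm_ge0 andbT eq_sym; apply: contraNN v0.
rewrite sqnormE psumr_eq0 => [/allP v0|i _]; last exact: sqr_ge0.
apply/eqP/colP => i; rewrite mxE; apply/eqP.
by have := v0 i (mem_index_enum _); rewrite sqrf_eq0.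
Qed.

Lemma trmxZ m n (a : R) (M : 'M[R]_(m, n)) : (a *: M)^T = a *: M^T.
Proof. exact: linearZ. Qed.

Lemma posdef_congr n (M B : 'M[R]_n) : M \in unitmx ->
  posdef B -> posdef (M *m B *m M^T).
Proof.
move=> uM [sB pB]; split; first by rewrite !trmx_mul trmxK sB mulmxA.
move=> v v0; have := pB (M^T *m v); rewrite trmx_mul trmxK !mulmxA; apply.
apply: contraNneq v0 => Mv.
by rewrite -(mulKmx (_ : M^T \in unitmx) v) ?unitmx_tr// Mv mulmx0.
Qed.

Lemma posdef_congrE n (M B : 'M[R]_n) : M \in unitmx ->
  posdef (M *m B *m M^T) <-> posdef B.
Proof.
move=> uM; split=> [|]; last exact: posdef_congr.
move=> /(@posdef_congr _ (invmx M)); rewrite unitmx_inv => /(_ uM).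
by rewrite !mulmxA mulVmx// mul1mx -mulmxA -trmx_mul mulVmx// trmx1 mulmx1.
Qed.

Lemma posdef_block n (b : R) (S : 'M[R]_n) :
  posdef (block_mx b%:M 0 0 S : 'M[R]_(1 + n)) <-> 0 < b /\ posdef S.
Proof.
have quad (x : 'cV[R]_1) (y : 'cV[R]_n) :
    ((col_mx x y)^T *m block_mx b%:M 0 0 S *m col_mx x y) 0 0 =
    b * x 0 0 ^+ 2 + (y^T *m S *m y) 0 0.
  rewrite tr_col_mx mul_row_block mul_row_col !mulmx0 addr0 add0r mxE.
  congr (_ + _); rewrite mul_mx_scalar -scalemxAl mxE [(x^T *m x) 0 0]mxE.
  by rewrite big_ord1 mxE expr2.
split=> [[sB pB]|[b0 [sS pS]]].
  split.
    have := pB (col_mx 1 0); rewrite quad mxE expr1n mulr1 mulmx0 [X in _ + X]mxE addr0.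
    apply; apply/eqP => /matrixP/(_ (lshift _ 0) 0); rewrite col_mxEu !mxE => /eqP.
    by rewrite oner_eq0.
  split=> [|v v0].
    by move: sB; rewrite tr_block_mx => /eq_block_mx[].
  have := pB (col_mx 0 v); rewrite quad mxE expr0n mulr0 add0r; apply.
  apply: contraNneq v0 => v0; apply/eqP/colP => i.
  by have /matrixP/(_ (rshift _ i) 0) := v0; rewrite col_mxEd !mxE.
split; first by rewrite tr_block_mx !trmx0 tr_scalar_mx sS.
move=> v; rewrite -[v]vsubmxK quad.
have [->|y0 _] := eqVneq (dsubmx v) 0; last first.
  by rewrite ltr_wpDl ?pS// mulr_ge0 ?sqr_ge0// ltW.
move=> x0; rewrite mulmx0 [X in _ + X]mxE addr0 mulr_gt0// exprn_even_gt0//=.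
apply: contraNneq x0 => x0; apply/eqP/colP => i; rewrite [RHS]mxE.
case: (splitP i) => j ij.
  have -> : i = lshift n j by exact: val_inj.
  by rewrite col_mxEu ord1 x0.
have -> : i = rshift 1 j by exact: val_inj.
by rewrite col_mxEd mxE.
Qed.

(** Unipotent factor of the block decomposition [E D E^T] with [D] block diagonal. Having
    determinant 1, it transports both positive definiteness and the determinant to the Schur
    complement. *)
Let schur_factor n (b : R) (u : 'rV[R]_n) : 'M[R]_(1 + n) :=
  block_mx 1 0 (b^-1 *: u^T) 1%:M.

Let det_schur_factor n b (u : 'rV[R]_n) : \det (schur_factor b u) = 1.
Proof. by rewrite /schur_factor det_lblock !det1 mulr1. Qed.

Let schur_factorE n (b : R) (u : 'rV[R]_n) (D : 'M[R]_n) : b != 0 ->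
  schur_factor b u *m block_mx b%:M 0 0 (D - b^-1 *: (u^T *m u)) *m
    (schur_factor b u)^T = block_mx b%:M u u^T D.
Proof.
move=> b0; rewrite /schur_factor.
rewrite tr_block_mx !trmx1 trmx0 trmxZ trmxK !mulmx_block.
rewrite !(mulmx0, mul0mx, mulmx1, mul1mx, addr0, add0r).
rewrite !mul_mx_scalar mul_scalar_mx !scalerA divff// !scale1r.
by rewrite -scalemxAr addrC subrK.
Qed.

Lemma posdef_schur n (b : R) (u : 'rV[R]_n) (D : 'M[R]_n) : b != 0 ->
  posdef (block_mx b%:M u u^T D : 'M[R]_(1 + n)) <->
  0 < b /\ posdef (D - b^-1 *: (u^T *m u)).
Proof.
move=> b0; rewrite -posdef_block -(schur_factorE _ _ b0) posdef_congrE//.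
by rewrite unitmxE det_schur_factor unitr1.
Qed.

Lemma det_schur n (b : R) (u : 'rV[R]_n) (D : 'M[R]_n) : b != 0 ->
  \det (block_mx b%:M u u^T D : 'M[R]_(1 + n)) =
  b * \det (D - b^-1 *: (u^T *m u)).
Proof.
move=> b0; rewrite -(schur_factorE _ _ b0) !det_mulmx det_tr det_schur_factor.
by rewrite mulr1 mul1r det_lblock det_scalar1.
Qed.

(** [X *m Y] and [Y *m X] have the same determinant; both products are block triangular, and their
    diagonal blocks give the two sides. *)
Lemma det_rank1_update n (w : 'cV[R]_n) :
  \det (1%:M + w *m w^T) = 1 + \sum_i w i 0 ^+ 2.
Proof.
pose X : 'M[R]_(1 + n) := block_mx 1 (- w^T) w 1%:M.
pose Y : 'M[R]_(1 + n) := block_mx 1 w^T 0 1%:M.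
have detXY : \det (X *m Y) = \det (1%:M + w *m w^T).
  rewrite mulmx_block !(mulmx0, mulmx1, mul1mx, addr0) subrr det_lblock det1.
  by rewrite mul1r addrC.
have detYX : \det (Y *m X) = 1 + (w^T *m w) 0 0.
  rewrite mulmx_block !(mul0mx, mulmx1, mul1mx, add0r) addNr det_lblock det1.
  by rewrite mulr1 det_mx11 mxE mxE eqxx.
by rewrite -sqnormE -detYX -detXY !det_mulmx mulrC.
Qed.

Lemma posdef_head n (b : R) (u : 'rV[R]_n) (D : 'M[R]_n) :
  posdef (block_mx b%:M u u^T D : 'M[R]_(1 + n)) -> 0 < b.
Proof.
move=> [_ /(_ (col_mx 1 0))].
rewrite tr_col_mx mul_row_block mul_row_col trmx0 !mul0mx !mulmx0 !addr0 mulmx1 trmx1 mul1mx.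
rewrite mxE eqxx mulr1n; apply.
apply/eqP => /matrixP/(_ (lshift _ 0) 0); rewrite col_mxEu !mxE => /eqP.
by rewrite oner_eq0.
Qed.

(** Either side forces [0 < b]: on the left, [b] is the value of the quadratic form at the first
    basis vector. *)
Lemma posdef_schurE n (b : R) (u : 'rV[R]_n) (D : 'M[R]_n) :
  posdef (block_mx b%:M u u^T D : 'M[R]_(1 + n)) <->
  0 < b /\ posdef (D - b^-1 *: (u^T *m u)).
Proof.
split=> [pB|[b0]]; last by move=> pS; apply/posdef_schur; rewrite ?gt_eqF.
by apply/posdef_schur => //; rewrite gt_eqF//; exact: posdef_head pB.
Qed.

Lemma sym_blockK n (B : 'M[R]_(1 + n)) : B^T = B ->
  B = block_mx (B 0 0)%:M (ursubmx B) (ursubmx B)^T (drsubmx B).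
Proof.
move=> sB; rewrite -[LHS]submxK; congr block_mx; last by rewrite trmx_ursub sB.
apply/matrixP => i j; rewrite !ord1 !mxE eqxx mulr1n.
by congr (B _ _); exact: val_inj.
Qed.

Lemma posdef_schur_sym n (B : 'M[R]_(1 + n)) : B^T = B ->
  posdef B <-> 0 < B 0 0 /\
    posdef (drsubmx B - (B 0 0)^-1 *: ((ursubmx B)^T *m ursubmx B)).
Proof. by move=> sB; rewrite -posdef_schurE -(sym_blockK sB). Qed.

(** Induction on the size: the Schur complement of the head entry is factored, and the first column
    is [sqrt b] followed by [u^T / sqrt b]. *)
Lemma cholesky n (B : 'M[R]_n) : posdef B ->
  exists L : 'M[R]_n, [/\ is_trig_mx L, forall i, 0 < L i i & B = L *m L^T].
Proof.
elim: n B => [|n ih] B pB.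
  by exists 1%:M; split; [exact: scalar_mx_is_trig|case|apply/matrixP; case].
have [sB _] := pB; move: pB; rewrite (@sym_blockK n _ sB).
set b := B 0 0; set u := @ursubmx _ 1 n 1 n B; set D := drsubmx _.
move=> /posdef_schurE [b0 /ih[L [tL L0 LE]]].
exists (block_mx (Num.sqrt b)%:M 0 ((Num.sqrt b)^-1 *: u^T) L).
have s0 : 0 < Num.sqrt b by rewrite sqrtr_gt0.
split.
- rewrite (@is_trig_block_mx _ 1 n 1 n)// eqxx tL andbT /=; exact: scalar_mx_is_trig.
- move=> i; case: (@splitP 1 n i) => j ij.
    have -> : i = lshift n j by exact: val_inj.
    by rewrite (@block_mxEul _ 1 n 1 n) ord1 mxE.
  have -> : i = rshift 1 j by exact: val_inj.
  by rewrite (@block_mxEdr _ 1 n 1 n).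
rewrite (@tr_block_mx _ 1 n 1 n) (@mulmx_block _ 1 n 1 n 1 n) !trmx0 !(mulmx0, mul0mx, addr0) tr_scalar_mx.
rewrite trmxZ trmxK -scalar_mxM -expr2 sqr_sqrtr ?ltW//.
rewrite mul_scalar_mx mul_mx_scalar !scalerA mulfV ?gt_eqF// !scale1r.
rewrite -scalemxAl -scalemxAr scalerA -invfM -expr2 sqr_sqrtr ?ltW// -LE.
by rewrite addrC subrK.
Qed.

Lemma trig_det_gt0 n (L : 'M[R]_n) : is_trig_mx L -> (forall i, 0 < L i i) ->
  0 < \det L.
Proof. by move=> tL L0; rewrite det_trig// prodr_gt0. Qed.

Lemma posdef_det_gt0 n (B : 'M[R]_n) : posdef B -> 0 < \det B.
Proof.
move=> /cholesky[L [tL L0 ->]]; rewrite det_mulmx det_tr.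
by rewrite mulr_gt0 ?trig_det_gt0.
Qed.

Lemma posdef_unit n (B : 'M[R]_n) : posdef B -> B \in unitmx.
Proof. by move=> /posdef_det_gt0; rewrite unitmxE unitfE => /lt0r_neq0. Qed.

Lemma posdefD_scalar n (B : 'M[R]_n) (t : R) : 0 <= t -> posdef B ->
  posdef (t%:M + B).
Proof.
move=> t0 [sB pB]; split; first by rewrite linearD /= tr_scalar_mx sB.
move=> v v0; rewrite mulmxDr mulmxDl mxE ltr_wpDl ?pB//.
by rewrite mul_mx_scalar -scalemxAl mxE mulr_ge0 ?sqnorm_ge0.
Qed.

Lemma posdefD_rank1 n (B : 'M[R]_n) (t : R) (u : 'cV[R]_n) : 0 <= t ->
  posdef B -> posdef (B + t *: (u *m u^T)).
Proof.
move=> t0 [sB pB]; split; first by rewrite linearD /= trmxZ trmx_mul trmxK sB.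
move=> v v0; rewrite mulmxDr mulmxDl mxE ltr_wpDr ?pB//.
rewrite -scalemxAr -scalemxAl mxE mulr_ge0//.
have -> : v^T *m (u *m u^T) *m v = (u^T *m v)^T *m (u^T *m v).
  by rewrite trmx_mul trmxK !mulmxA.
exact: sqnorm_ge0.
Qed.

Lemma trig_invmx n (L : 'M[R]_n) : is_trig_mx L -> (forall i, 0 < L i i) ->
  is_trig_mx (invmx L) /\ (forall i, invmx L i i = (L i i)^-1).
Proof.
move=> tL L0; have uL : L \in unitmx.
  by rewrite unitmxE unitfE gt_eqF// trig_det_gt0.
have LM i j : \sum_k L i k * invmx L k j = (i == j)%:R.
  by have /matrixP/(_ i j) := mulmxV uL; rewrite !mxE.
have /is_trig_mxP L_ := tL.
(* Forward substitution in [L *m invmx L = 1]: in row [i] the terms [k > i] vanish with [L i k], the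
   terms [k < i] by induction, which leaves [L i i * invmx L i j = 0]. *)
have M_ (i j : 'I_n) : (i < j)%N -> invmx L i j = 0.
  have [m] := ubnP i; elim: m i => // m ih i; rewrite ltnS => im ij.
  have := LM i j; rewrite (bigD1 i)//= big1 => [|k ki]; last first.
    have [ik|ki'|/val_inj ki'] := ltngtP i k; first by rewrite L_// mul0r.
      by rewrite ih ?mulr0//; [exact: leq_trans im|exact: ltn_trans ij].
    by rewrite ki' eqxx in ki.
  have -> : (i == j) = false by apply/negbTE; rewrite neq_ltn ij.
  by move/eqP; rewrite addr0 mulf_eq0 gt_eqF//= => /eqP.
split; first exact/is_trig_mxP.
move=> i; have := LM i i; rewrite (bigD1 i)//= big1 => [|k ki]; last first.
  have [ik|ki'|/val_inj ki'] := ltngtP i k; first by rewrite L_// mul0r.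
    by rewrite M_ ?mulr0.
  by rewrite ki' eqxx in ki.
rewrite eqxx addr0 => LMi; apply: (mulfI (lt0r_neq0 (L0 i))).
by rewrite LMi mulfV// gt_eqF.
Qed.
End PosDef.

(** * Spectral theorem, eigenvalues and the positive definite square root *)

Section Spectral.
(* [C] will be [R[i]]; conversion diverges in practice on the concrete type. *)
Variables (R : realType) (C : numClosedFieldType) (toC : {rmorphism R -> C}).
Hypothesis toC_real : forall z, reflect (exists x, z = toC x) (z \is Num.real).

(** [P] has entries in [C], where the spectral theorem applies, while the eigenvalues [d] are real.
    With [P] invertible, traces, determinants, powers and inverses can be read off [d]. *)
Definition diagonalized n (B : 'M[R]_n) (P : 'M[C]_n) (d : 'I_n -> R) :=
  map_mx toC B = invmx P *m diag_mx (\row_i toC (d i)) *m P.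

Lemma det_diagonalized n (B : 'M[R]_n) P d : P \in unitmx ->
  diagonalized B P d -> \det B = \prod_i d i.
Proof.
move=> uP dB; apply: (fmorph_inj toC); rewrite -det_map_mx dB !det_mulmx.
rewrite det_inv mulrC mulrA mulfV ?mul1r; last by move: uP; rewrite unitmxE unitfE.
by rewrite det_diag rmorph_prod; apply: eq_bigr => i _; rewrite mxE.
Qed.

Lemma trace_diagonalized n (B : 'M[R]_n) P d : P \in unitmx ->
  diagonalized B P d -> \tr B = \sum_i d i.
Proof.
move=> uP dB; apply: (fmorph_inj toC); rewrite -trace_map_mx dB mxtrace_mulC.
rewrite mulmxA mulmxV// mul1mx mxtrace_diag rmorph_sum.
by apply: eq_bigr => i _; rewrite mxE.
Qed.

Lemma diagonalizedD n (B : 'M[R]_n) P d t : P \in unitmx ->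
  diagonalized B P d -> diagonalized (t%:M + B) P (fun i => t + d i).
Proof.
move=> uP dB; rewrite /diagonalized map_mxD dB map_scalar_mx.
rewrite (_ : \row_i toC (t + d i) = const_mx (toC t) + \row_i toC (d i)); last first.
  by apply/rowP => i; rewrite !mxE -rmorphD.
rewrite linearD /= diag_const_mx mulmxDr mulmxDl; congr (_ + _).
by rewrite mul_mx_scalar -scalemxAl mulVmx// scalemx1.
Qed.

Lemma diagonalizedM n (A B : 'M[R]_n) P a b : P \in unitmx ->
  diagonalized A P a -> diagonalized B P b ->
  diagonalized (A *m B) P (fun i => a i * b i).
Proof.
move=> uP dA dB; rewrite /diagonalized map_mxM dA dB.
rewrite !mulmxA (mulmxK uP) -[_ *m diag_mx _ *m diag_mx _]mulmxA mulmx_diag.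
rewrite [X in diag_mx X](_ : _ = \row_i toC (a i * b i))//.
by apply/rowP => i; rewrite !mxE rmorphM.
Qed.

Lemma diagonalized1 n (P : 'M[C]_n) : P \in unitmx ->
  diagonalized (1%:M) P (fun=> 1).
Proof.
move=> uP; rewrite /diagonalized map_mx1 (_ : \row_i _ = const_mx 1).
  by rewrite diag_const_mx mulmx1 mulVmx.
by apply/rowP => i; rewrite !mxE rmorph1.
Qed.

Lemma diagonalized_pow n (A : 'M[R]_n) P d q : P \in unitmx ->
  diagonalized A P d -> diagonalized (mxpow A q) P (fun i => d i ^+ q).
Proof.
move=> uP dA; elim: q => [|q ih]; first exact: diagonalized1.
have -> : (fun i => d i ^+ q.+1) = (fun i => d i * d i ^+ q).
  by apply/funext => i; rewrite exprS.
exact: diagonalizedM.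
Qed.

Lemma diagonalized_inj n (A B : 'M[R]_n) P d : diagonalized A P d ->
  diagonalized B P d -> A = B.
Proof. by rewrite /diagonalized => <- /map_mx_inj. Qed.

Lemma diagonalized_inv n (A : 'M[R]_n) P d : A \in unitmx -> P \in unitmx ->
  (forall i, d i != 0) ->
  diagonalized A P d -> diagonalized (invmx A) P (fun i => (d i)^-1).
Proof.
move=> uA uP d0 dA; rewrite /diagonalized.
set X := RHS; have uA' : map_mx toC A \in unitmx by rewrite map_unitmx.
suff : map_mx toC A *m X = 1%:M.
  by rewrite map_invmx => AX; rewrite -[RHS](mulKmx uA') AX mulmx1.
rewrite dA /X !mulmxA (mulmxK uP) -[_ *m diag_mx _ *m diag_mx _]mulmxA mulmx_diag.
rewrite (_ : \row_i _ = const_mx 1).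
  by rewrite diag_const_mx mulmx1 mulVmx.
by apply/rowP => i; rewrite !mxE -rmorphM mulfV// rmorph1.
Qed.

(** Over [C] the matrix is Hermitian, hence normal with real spectrum. *)
Lemma posdef_spectral n (B : 'M[R]_n) : posdef B ->
  exists P d, [/\ P \in unitmx, forall i, 0 < d i & diagonalized B P d].
Proof.
move=> pB; have [sB _] := pB; pose A := map_mx toC B.
have Ar : A \is a realmx.
  by apply/mxOverP => i j; rewrite mxE; apply/toC_real; exists (B i j).
have As : A \is symmetricmx.
  by apply/is_hermitianmxP; rewrite expr0 scale1r map_mx_id// map_trmx sB.
have Ah := realsym_hermsym As Ar.
have /orthomx_spectralP AE := hermitian_normalmx Ah.
have dr := hermitian_spectral_diag_real Ah.
have /choice[d dE] : forall i, exists x, spectral_diag A 0 i = toC x.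
  by move=> i; apply/toC_real; exact: (mxOverP dr).
have dB : diagonalized B (spectralmx A) d.
  rewrite /diagonalized -/A [LHS]AE [X in diag_mx X](_ : _ = \row_i toC (d i))//.
  by apply/rowP => i; rewrite mxE dE.
exists (spectralmx A), d; split=> //; first exact: spectral_unit.
(* Were [d i <= 0], the matrix [- d i + B] would be positive definite, yet its determinant contains
   the factor [- d i + d i = 0]. *)
move=> i; rewrite ltNge; apply/negP => di.
have := posdef_det_gt0 (posdefD_scalar (_ : 0 <= - d i) pB).
rewrite (det_diagonalized _ (diagonalizedD (- d i) _ dB)) ?spectral_unit//.
by rewrite (bigD1 i)//= addNr mul0r ltxx oppr_ge0 => /(_ di).
Qed.

(** Nodes are added one at a time, correcting by a multiple of the polynomial [g] that vanishes at
    all earlier nodes. *)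
Lemma interpolation (s : seq R) (f : R -> R) :
  exists p : {poly R}, {in s, forall x, p.[x] = f x}.
Proof.
elim: s => [|x s [p pP]]; first by exists 0.
have [xs|xs] := boolP (x \in s).
  by exists p => y; rewrite inE => /predU1P[->|]; exact: pP.
pose g : {poly R} := \prod_(z <- s) ('X - z%:P).
have gx : g.[x] != 0.
  rewrite horner_prod prodf_seq_neq0; apply/allP => z zs /=.
  by rewrite hornerXsubC subr_eq0; apply: contraNneq xs => ->.
exists (p + ((f x - p.[x]) / g.[x]) *: g) => y; rewrite inE hornerD hornerZ.
have [-> _|yx /= ys] := eqVneq y x; first by rewrite divfK// addrC subrK.
suff -> : g.[y] = 0 by rewrite mulr0 addr0 pP.
by apply/rootP; rewrite /g root_prod_XsubC.
Qed.

Lemma horner_mx_sym n (B : 'M[R]_n.+1) (p : {poly R}) :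
  B^T = B -> (horner_mx B p)^T = horner_mx B p.
Proof.
move=> sB; elim/poly_ind: p => [|p c ih]; first by rewrite rmorph0 trmx0.
rewrite rmorphD rmorphM /= horner_mx_X horner_mx_C linearD /= tr_scalar_mx.
by rewrite trmx_mul ih sB (comm_mx_horner p (erefl : comm_mx B B)).
Qed.

(** A real polynomial in [B] is a real symmetric matrix although the diagonalization is complex.
    Interpolating fourth roots on the spectrum gives [Q] with [Q^4 = B]; then [Q^2 = Q^T Q] is
    positive definite because [Q] is invertible. *)
Lemma posdef_sqrt n (B : 'M[R]_n) : posdef B ->
  exists S : 'M[R]_n, posdef S /\ S *m S = B.
Proof.
case: n B => [|n] B pB; first by exists B; split=> //; apply/matrixP => - [].
have [P [d [uP d0 dB]]] := posdef_spectral pB.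
have [sB _] := pB.
have [p pE] := interpolation (codom d) (fun x => Num.sqrt (Num.sqrt x)).
pose Q := horner_mx B p.
have sQ : Q^T = Q by apply: horner_mx_sym.
have dQ : diagonalized Q P (fun i => Num.sqrt (Num.sqrt (d i))).
  rewrite /diagonalized map_horner_mx dB horner_mx_uconjC// horner_mx_diag.
  rewrite [X in diag_mx X](_ : _ = \row_i toC (Num.sqrt (Num.sqrt (d i))))//.
  by apply/rowP => i; rewrite !mxE horner_map /= pE ?codom_f.
have QB : (Q *m Q) *m (Q *m Q) = B.
  have dQ2 := diagonalizedM uP dQ dQ.
  apply: (@diagonalized_inj _ _ _ P d) => //.
  have -> : d = (fun i => Num.sqrt (Num.sqrt (d i)) * Num.sqrt (Num.sqrt (d i)) *
      (Num.sqrt (Num.sqrt (d i)) * Num.sqrt (Num.sqrt (d i)))).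
    by apply/funext => i; rewrite -!expr2 !sqr_sqrtr ?sqrtr_ge0// ltW.
  exact: diagonalizedM.
exists (Q *m Q); split=> //; split; first by rewrite trmx_mul sQ.
move=> v v0; rewrite -{1}sQ mulmxA -trmx_mul -mulmxA sqnorm_gt0//.
have uQ : Q \in unitmx.
  have := posdef_unit pB; rewrite -QB !unitmx_mul => /andP[/andP[]] //.
by apply: contraNneq v0 => Qv; rewrite -(mulKmx uQ v) Qv mulmx0.
Qed.

Lemma eigenvalues_spec n (B : 'M[R]_n) : posdef B -> exists d : 'I_n -> R,
  [/\ forall i, 0 < d i, \det B = \prod_i d i, \det (1%:M + B) = \prod_i (1 + d i)
    & forall q, \tr (mxpow (invmx B) q) = \sum_i (d i)^-1 ^+ q].
Proof.
move=> pB; have [P [d [uP d0 dB]]] := posdef_spectral pB; exists d; split=> //.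
- exact: det_diagonalized dB.
- exact: det_diagonalized (diagonalizedD 1 uP dB).
move=> q; apply: (trace_diagonalized uP); apply: (diagonalized_pow _ uP).
by apply: diagonalized_inv => //; [exact: posdef_unit|move=> i; rewrite gt_eqF].
Qed.

End Spectral.

Section RealSpectral.
Variable R : realType.

Let toC_real (z : R[i]%C) : reflect (exists x, z = real_complex R x) (z \is Num.real).
Proof. exact: complex_realP. Qed.

Lemma posdef_eigenvalues n (B : 'M[R]_n) : posdef B -> exists d : 'I_n -> R,
  [/\ forall i, 0 < d i, \det B = \prod_i d i, \det (1%:M + B) = \prod_i (1 + d i)
    & forall q, \tr (mxpow (invmx B) q) = \sum_i (d i)^-1 ^+ q].
Proof. exact: (@eigenvalues_spec R R[i]%C (real_complex R) toC_real). Qed.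

Lemma mx_sqrtP n (B : 'M[R]_n) : posdef B ->
  posdef (mx_sqrt B) /\ mx_sqrt B *m mx_sqrt B = B.
Proof.
move=> /(posdef_sqrt toC_real)[S SP].
by rewrite /mx_sqrt; case: xgetP => // /(_ S).
Qed.

End RealSpectral.

(** * Iterated integrals *)

Section IteratedIntegral.
Variables (R : realType).
Notation mu := (@lebesgue_measure R).

Section affine.
Local Open Scope ereal_scope.

Let affine (l c : R) : measurableTypeR R -> measurableTypeR R :=
  fun x => (l * x + c)%R.

Let measurable_affine l c : measurable_fun setT (affine l c).
Proof. by apply: measurable_funD => //; apply: measurable_funM. Qed.

(** By uniqueness of Lebesgue measure it suffices to compare with [|l|] times the pushforward on
    half-open intervals. *)
Lemma lebesgue_measure_affine (l c : R) (A : set (measurableTypeR R)) :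
  l != 0%R -> measurable A ->
  mu A = `|l|%:E * mu ((fun x => l * x + c)%R @^-1` A).
Proof.
move=> l0 mA.
pose phi : {mfun measurableTypeR R >-> measurableTypeR R} :=
  HB.pack (affine l c) (isMeasurableFun.Build _ _ _ _ _ (@measurable_affine l c)).
apply: (lebesgue_measure_unique (mu := mscale (NngNum (normr_ge0 l)) (pushforward mu phi))) => //= _ [[a b]] _ <-.
rewrite /mscale /=; unfold pushforward.
have [lgt0|llt0|] := ltgtP 0%R l; last by move/eqP; rewrite eq_sym (negbTE l0).
- rewrite [X in _ * mu X](_ : _ = `]((a - c) / l)%R, ((b - c) / l)%R]%classic); last first.
    apply/seteqP; split => x /=; rewrite !in_itv /= ltr_pdivrMr// ler_pdivlMr// /affine mulrC;
      by rewrite ltrBlDr lerBrDr.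
  rewrite !lebesgue_measure_itv /= !lte_fin ltr_pM2r ?invr_gt0// ltrD2r.
  case: ifP => _; last by rewrite mule0.
  rewrite -!EFinB -EFinM gtr0_norm//; congr (_%:E); by field.
(* A negative slope reverses the interval, so its closed end moves to the left; the length is
   unaffected. *)
- rewrite [X in _ * mu X](_ : _ = `[((b - c) / l)%R, ((a - c) / l)%R[%classic); last first.
    apply/seteqP; split => x /=; rewrite !in_itv /= ltr_ndivlMr// ler_ndivrMr// /affine mulrC;
      by rewrite ltrBlDr lerBrDr andbC.
  rewrite !lebesgue_measure_itv /= !lte_fin ltr_nM2r ?invr_lt0// ltrD2r.
  case: ifP => _; last by rewrite mule0.
  rewrite -!EFinB -EFinM ltr0_norm//; congr (_%:E); by field.
Qed.

Lemma ge0_integral_affine (l c : R) (f : R -> \bar R) : l != 0%R ->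
  measurable_fun [set: R] f -> (forall x, 0 <= f x) ->
  \int[mu]_(x in setT) f (l * x + c)%R = `|l|^-1%:E * \int[mu]_(x in setT) f x.
Proof.
move=> l0 mf f0.
pose phi : {mfun measurableTypeR R >-> measurableTypeR R} :=
  HB.pack (affine l c) (isMeasurableFun.Build _ _ _ _ _ (@measurable_affine l c)).
have -> : \int[mu]_(x in setT) f x =
    \int[mscale (NngNum (normr_ge0 l)) (pushforward mu phi)]_(x in setT) f x.
  move=> mphi; apply: eq_measure_integral => A mA _.
  exact: (@lebesgue_measure_affine l c).
rewrite ge0_integral_mscale//= (ge0_integral_pushforward (@measurable_affine l c))//.
by rewrite muleA -EFinM mulVf ?normr_eq0// mul1e.
Qed.
End affine.

Section iint.
Variable I : eqType.
Implicit Types (e : I -> R) (s : seq I) (F G : (I -> R) -> \bar R).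
Local Open Scope ereal_scope.

Definition upd e (i : I) (x : R) : I -> R := fun k => if k == i then x else e k.

(** Coordinates outside [s] are parameters read from [e]; those in [s] are overwritten. The index
    type is arbitrary so that vectors and symmetric matrices share one calculus. *)
Fixpoint iint s F e : \bar R :=
  match s with
  | [::] => F e
  | i :: s' => \int[mu]_(x in setT) iint s' F (upd e i x)
  end.

(* Borel measurability on the (possibly infinite) power [R^I], tested on all
   measurable maps into it; this makes composition and partial integration
   immediate without a sigma-algebra on [I -> R]. *)
Definition emeas F := forall d (T : measurableType d) (f : T -> I -> R),
  (forall i, measurable_fun setT (fun t => f t i)) ->
  measurable_fun setT (fun t => F (f t)).

Lemma updii e i x : upd e i x i = x. Proof. by rewrite /upd eqxx. Qed.
Lemma upd_neq e i x k : k != i -> upd e i x k = e k.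
Proof. by rewrite /upd => /negbTE->. Qed.

(** Joint measurability in [(t, x)] is an instance of [emeas] on the product space, and Tonelli then
    gives measurability of the partial integral. *)
Lemma emeas_int F i : emeas F -> (forall e, 0 <= F e) ->
  emeas (fun e => \int[mu]_(x in setT) F (upd e i x)).
Proof.
move=> mF F0 d T f mf.
pose h (z : T * measurableTypeR R) := F (upd (f z.1) i z.2).
have mh : measurable_fun setT h.
  apply: (mF _ _ (fun z : T * measurableTypeR R => upd (f z.1) i z.2)) => k.
  rewrite /upd; case: eqP => _; first exact: measurable_snd.
  apply: measurableT_comp (mf k) _; exact: measurable_fst.
have h0 z : 0 <= h z by exact: F0.
exact: (@measurable_fun_fubini_tonelli_F _ _ _ _ R mu h mh h0).
Qed.

Lemma iint_ge0 s F e : (forall e, 0 <= F e) -> 0 <= iint s F e.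
Proof.
move=> F0; elim: s e => [|i s ih] e /=; first exact: F0.
by apply: integral_ge0 => x _; exact: ih.
Qed.

Lemma emeas_iint s F : emeas F -> (forall e, 0 <= F e) -> emeas (iint s F).
Proof.
move=> mF F0; elim: s => [|i s ih] //=.
by apply: emeas_int => // e; exact: iint_ge0.
Qed.

Lemma emeas_upd F e i : emeas F ->
  measurable_fun [set: R] (fun x => F (upd e i x)).
Proof.
move=> mF; apply: mF => k; rewrite /upd; case: eqP => _; first exact: measurable_id.
exact: measurable_cst.
Qed.

Lemma iint_le s F G e : emeas F -> emeas G -> (forall e, 0 <= F e) ->
  (forall e, F e <= G e) -> iint s F e <= iint s G e.
Proof.
move=> mF mG F0 FG; have G0 e' : 0 <= G e' by exact: le_trans (FG e').
elim: s e => [|i s ih] e //=.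
by apply: ge0_le_integral => //;
   do ?[by move=> x _; exact: iint_ge0 | by apply: emeas_upd; exact: emeas_iint].
Qed.

Lemma iint_scale s F k e : emeas F -> (forall e, 0 <= F e) -> (0 <= k)%R ->
  iint s (fun e => k%:E * F e) e = k%:E * iint s F e.
Proof.
move=> mF F0 k0; elim: s e => [|i s ih] e //=.
under eq_integral do rewrite ih.
rewrite ge0_integralZl_EFin //; first by move=> x _; exact: iint_ge0.
by apply: emeas_upd; exact: emeas_iint.
Qed.

Lemma iint_cat s1 s2 F e : iint (s1 ++ s2) F e = iint s1 (iint s2 F) e.
Proof. by elim: s1 e => //= i s ih e; apply: eq_integral => x _. Qed.

Lemma updC e i j x y : i != j -> upd (upd e i x) j y = upd (upd e j y) i x.
Proof.
move=> ij; apply/funext => k; rewrite /upd.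
by case: (eqVneq k j) => // ->; rewrite eq_sym (negbTE ij).
Qed.

Lemma iint_swap i j F e : emeas F -> (forall e, 0 <= F e) ->
  iint [:: i; j] F e = iint [:: j; i] F e.
Proof.
move=> mF F0; have [->//|ij] := eqVneq i j.
pose h (z : measurableTypeR R * measurableTypeR R) := F (upd (upd e i z.1) j z.2).
have mh : measurable_fun setT h.
  apply: (mF _ _ (fun z : measurableTypeR R * measurableTypeR R =>
     upd (upd e i z.1) j z.2)) => k.
  rewrite /upd; case: eqP => _; first exact: measurable_snd.
  by case: eqP => _; [exact: measurable_fst|exact: measurable_cst].
have h0 z : 0 <= h z by exact: F0.
have := @fubini_tonelli _ _ _ _ R mu mu h mh h0; rewrite /h /= => ->.
by apply: eq_integral => y _; apply: eq_integral => x _; rewrite updC.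
Qed.

Lemma iint_front i s1 s2 F e : emeas F -> (forall e, 0 <= F e) ->
  iint (s1 ++ i :: s2) F e = iint (i :: s1 ++ s2) F e.
Proof.
move=> mF F0; elim: s1 e => // j s ih e.
transitivity (iint [:: j; i] (iint (s ++ s2) F) e).
  by rewrite [LHS]/=; apply: eq_integral => x _; rewrite ih.
rewrite iint_swap //; first exact: emeas_iint.
by move=> ?; exact: iint_ge0.
Qed.

(** The head of [s1] is located in [s2] and moved to its front by adjacent swaps, each an instance
    of Tonelli. *)
Lemma iint_perm s1 s2 F e : emeas F -> (forall e, 0 <= F e) ->
  perm_eq s1 s2 -> iint s1 F e = iint s2 F e.
Proof.
move=> mF F0; elim: s1 s2 e => [|i s ih] s2 e.
  by rewrite perm_sym => /perm_nilP ->.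
move=> p12; have i2 : i \in s2 by rewrite -(perm_mem p12) mem_head.
case/splitPr: i2 p12 => a b p12; rewrite iint_front //=.
apply: eq_integral => x _; apply: ih.
by move: p12; rewrite perm_sym (perm_catCA a [:: i] b) /= perm_cons perm_sym.
Qed.

(** If the integral were zero, [g] would vanish almost everywhere, but it is positive on a ball of
    measure [2r]. *)
Lemma integral_gt0 (g : R -> \bar R) (a r : R) : (0 < r)%R ->
  measurable_fun [set: R] g -> (forall x, 0 <= g x) ->
  (forall x, (`|x - a| < r)%R -> 0 < g x) -> 0 < \int[mu]_(x in setT) g x.
Proof.
move=> r0 mg g0 gpos; rewrite lt0e integral_ge0 // andbT; apply/negP => /eqP g_eq0.
have : ae_eq mu setT g (cst 0).
  apply/ae_eq_integral_abs => //.
  by rewrite -[RHS]g_eq0; apply: eq_integral => x _; rewrite gee0_abs.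
move=> [N [mN N0 sN]].
have : mu (ball a r) <= mu N.
  apply: le_measure; rewrite ?inE//; first exact: measurable_ball.
  move=> x; rewrite -ball_normE /= distrC => /gpos gx; apply: sN => /= /(_ Logic.I) gx0.
  by rewrite gx0 ltxx in gx.
by rewrite N0 (lebesgue_measure_ball _ (ltW r0)) leNgt lte_fin mulr2n addr_gt0.
Qed.

(** The neighbourhood of [a] is a cube, so it can be treated one coordinate at a time. *)
Lemma iint_gt0 s F (a : I -> R) (r : R) e :
  emeas F -> (forall e, 0 <= F e) -> (0 < r)%R ->
  (forall e, (forall i, (`|e i - a i| < r)%R) -> 0 < F e) ->
  (forall i, i \notin s -> (`|e i - a i| < r)%R) ->
  0 < iint s F e.
Proof.
move=> mF F0 r0 Fpos; elim: s e => [|i s ih] e es /=.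
  by apply: Fpos => i; exact: es.
apply: (@integral_gt0 _ (a i) r) => //.
- by apply: emeas_upd; exact: emeas_iint.
- by move=> x; exact: iint_ge0.
move=> x xr; apply: ih => k ks; rewrite /upd; case: eqP => [->//|/eqP ki].
by apply: es; rewrite inE negb_or ki.
Qed.
End iint.

(** [P] is a simulation relation, preserved when both families are updated at matching indices; it
    serves to rename coordinates along [h]. *)
Lemma iint_simul (I J : eqType) (h : J -> I) (s : seq J)
    (F : (I -> R) -> \bar R) (F' : (J -> R) -> \bar R)
    (P : (I -> R) -> (J -> R) -> Prop) :
  (forall e e' j x, j \in s -> P e e' -> P (upd e (h j) x) (upd e' j x)) ->
  (forall e e', P e e' -> F e = F' e') ->
  forall e e', P e e' -> iint (map h s) F e = iint s F' e'.
Proof.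
elim: s => [|j s ih] PU PF e e' pe /=; first exact: PF.
apply: eq_integral => x _; apply: ih => //; last by apply: PU => //; exact: mem_head.
by move=> e1 e1' k y ks; apply: PU; rewrite inE ks orbT.
Qed.

(** Every coordinate in [s] is overwritten before the integrand is evaluated, so the starting
    families matter only outside [s], and the integrands only on families agreeing with them
    there. *)
Lemma eq_iint (I : eqType) (s : seq I) (F G : (I -> R) -> \bar R) e e' :
  (forall i, i \notin s -> e i = e' i) ->
  (forall e1, (forall i, i \notin s -> e1 i = e i) -> F e1 = G e1) ->
  iint s F e = iint s G e'.
Proof.
elim: s e e' => [|i s ih] e e' ee FG /=.
  by have -> : e' = e by [apply/funext => i; rewrite ee]; exact: FG.
apply: eq_integral => x _; apply: ih => [k ks|e1 e1P].
  by rewrite /upd; case: eqP => // /eqP ki; apply: ee; rewrite inE negb_or ki.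
apply: FG => k; rewrite inE negb_or => /andP[ki ks].
by rewrite e1P// upd_neq.
Qed.

End IteratedIntegral.

(** * Triangular substitutions in iterated integrals *)

Section triangular.
Variables (R : realType) (I : eqType).
Notation mu := (@lebesgue_measure R).
Implicit Types (e : I -> R) (s : seq I) (F G : (I -> R) -> \bar R).
Local Open Scope ereal_scope.

Lemma iint_scale_dep s F (u : (I -> R) -> R) e : emeas F ->
  (forall e, 0 <= F e) -> (0 <= u e)%R ->
  (forall e1, (forall i, i \notin s -> e1 i = e i) -> u e1 = u e) ->
  iint s (fun e => (u e)%:E * F e) e = (u e)%:E * iint s F e.
Proof.
move=> mF F0 u0 uP; rewrite -iint_scale//.
by apply: eq_iint => // e1 /uP ->.
Qed.

Lemma iint_prod s (k : R -> R) e : uniq s -> measurable_fun [set: R] k ->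
  (forall x, 0 <= k x)%R ->
  iint s (fun e => (\prod_(i <- s) k (e i))%:E) e =
  \prod_(i <- s) \int[mu]_(x in setT) (k x)%:E.
Proof.
move=> us mk k0.
have mP s' : emeas (fun e => (\prod_(i <- s') k (e i))%:E).
  move=> d T f mf; apply/measurable_EFinP.
  by apply: measurable_prod => i _; exact: measurableT_comp.
have P0 s' e' : 0 <= (\prod_(i <- s') k (e' i))%:E.
  by rewrite lee_fin prodr_ge0.
elim: s us e => [_ e|i s ih /andP[/= is_ us] e] /=; first by rewrite !big_nil.
under eq_integral => x _.
  rewrite (@eq_iint _ _ s _ (fun e => (k (e i))%:E *
     (\prod_(i <- s) k (e i))%:E) _ (upd e i x))//; last first.
    by move=> e1 _; rewrite big_cons EFinM.
  rewrite iint_scale_dep//; last by move=> e1 /(_ i is_) ->.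
  rewrite updii ih//.
  over.
rewrite big_cons ge0_integralZr//.
- exact/measurable_EFinP.
- by move=> x _; rewrite lee_fin.
- by apply: prode_ge0 => j _; apply: integral_ge0 => x _; rewrite lee_fin.
Qed.

Variables (phi : (I -> R) -> I -> R) (l : I -> R).

(* The integrated coordinates are substituted from the innermost integral
   outwards, so each one may be sheared by the coordinates outside of it. *)
Fixpoint triangular_on s := match s with
  | [::] => True
  | i :: s' => [/\ forall e x j, j \notin i :: s' -> phi (upd e i x) j = phi e j,
      l i != 0%R, forall e, exists g, forall x, phi (upd e i x) i = (l i * x + g)%R
    & triangular_on s']
  end.

Lemma iint_triangular_on s F e : emeas F -> (forall e, 0 <= F e) ->
  triangular_on s ->
  iint s (F \o phi) e = (\prod_(i <- s) `|l i|^-1)%:E * iint s F (phi e).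
Proof.
move=> mF F0; elim: s e => [|i s ih] e /=; first by rewrite big_nil mul1e.
move=> [phij l0 phii tri].
have [g gE] := phii e.
transitivity (\int[mu]_(x in setT) ((\prod_(i <- s) `|l i|^-1)%:E *
    iint s F (upd (phi e) i (l i * x + g)%R))).
  apply: eq_integral => x _; rewrite ih//; congr (_ * _).
  apply: eq_iint => // j js; rewrite -gE /upd.
  by case: eqP => [->//|/eqP ji]; apply: phij; rewrite inE negb_or ji.
have mI := emeas_upd (phi e) i (emeas_iint s mF F0).
rewrite (ge0_integral_affine g l0 (f := fun x => (\prod_(i <- s) `|l i|^-1)%:E *
    iint s F (upd (phi e) i x))).
- rewrite ge0_integralZl_EFin//.
  + by rewrite muleA -EFinM big_cons.
  + by move=> x _; exact: iint_ge0.
  + by apply: prodr_ge0 => j _; rewrite invr_ge0.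
- by apply: emeasurable_funM.
- move=> x; apply: mule_ge0; last exact: iint_ge0.
  by rewrite lee_fin; apply: prodr_ge0 => j _; rewrite invr_ge0.
Qed.

(** [phi] at [j] may depend on another coordinate [i] only when [key i < key j]. Sorting by [key]
    puts the small keys outermost, where [triangular_on] wants them. *)
Lemma iint_triangular (key : I -> nat) s F e : emeas F -> (forall e, 0 <= F e) ->
  uniq s -> {in s, forall i, l i != 0%R} ->
  {in s, forall i e, exists g, forall x, phi (upd e i x) i = (l i * x + g)%R} ->
  {in s, forall i e x j, j != i -> (j \notin s) || (key j <= key i)%N ->
    phi (upd e i x) j = phi e j} ->
  emeas (F \o phi) ->
  iint s (F \o phi) e = (\prod_(i <- s) `|l i|^-1)%:E * iint s F (phi e).
Proof.
move=> mF F0 us l0 phii phij mFphi.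
pose r i j := (key i <= key j)%N.
have rt : transitive r by move=> ? ? ?; exact: leq_trans.
have rT : total r by move=> ? ?; exact: leq_total.
have ps : perm_eq s (sort r s) by rewrite perm_sym perm_sort.
have -> : (\prod_(i <- s) `|l i|^-1 = \prod_(i <- sort r s) `|l i|^-1)%R.
  exact: perm_big.
rewrite (iint_perm e mFphi (fun e => F0 (phi e)) ps) (iint_perm (phi e) mF F0 ps).
apply: iint_triangular_on => //.
have : pairwise r (sort r s) by rewrite -sorted_pairwise// sort_sorted.
have mem_s := perm_mem ps.
have : uniq (sort r s) by rewrite sort_uniq.
(* [s1] collects the coordinates already passed; sortedness bounds their keys by that of the current
   one, so updating it leaves them alone. *)
suff : forall s1 s2, (forall j, (j \in s) = (j \in s1 ++ s2)) -> uniq (s1 ++ s2) ->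
   pairwise r (s1 ++ s2) -> triangular_on s2.
  by move=> /(_ [::]); apply.
move=> s1 s2; elim: s2 s1 => [//|i s2 ih] s1 sE us12 pw /=.
have is_ : i \in s by rewrite sE mem_cat mem_head orbT.
split.
- move=> e' x j; rewrite inE negb_or => /andP[ji js2]; apply: phij => //.
  rewrite sE mem_cat inE (negbTE ji) (negbTE js2) !orbF /=.
  case: (boolP (j \in s1)) => //= js1.
  move: pw; rewrite pairwise_cat => /andP[/allrelP/(_ j i js1 (mem_head _ _))].
  by [].
- exact: l0.
- exact: phii.
- by apply: (ih (rcons s1 i)); rewrite cat_rcons.
Qed.

End triangular.

(** * Domination of the integrand *)

Section ScalarBounds.
Variable R : realType.

Lemma powR_expR_bounded (a : R) :
  exists2 K : R, 0 < K & forall x, 0 <= x -> powR (1 + x) a * expR (- (x / 2)) <= K.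
Proof.
pose N := (Num.bound (Num.max a 0)).+1; have N0 : 0 < N%:R :> R by rewrite ltr0n.
have aN : a <= N%:R.
  have : Num.max a 0 < (Num.bound (Num.max a 0))%:R.
    by apply: archi_boundP; rewrite le_max lexx orbT.
  rewrite gt_max => /andP[aN _]; rewrite (le_trans (ltW aN))// ler_nat.
  exact: leqnSn.
(* With [y = (1 + x) / (2N)], raising [y <= exp y] to the power [N] gives
   [(1 + x)^N <= (2N)^N exp ((1 + x) / 2)]. *)
exists ((2 * N%:R) ^+ N * expR (1 / 2)) => [|x x0].
  by rewrite mulr_gt0 ?expR_gt0// exprn_gt0// mulr_gt0.
have x1 : 1 <= 1 + x by rewrite lerDl.
rewrite expRN ler_pdivrMr ?expR_gt0// -mulrA -expRD -mulrDl.
apply: (le_trans (ler_powR x1 aN)); rewrite powR_mulrn ?addr_ge0//.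
have -> : 1 + x = (2 * N%:R) * ((1 + x) / (2 * N%:R)).
  by rewrite mulrC divfK// mulf_neq0 ?pnatr_eq0.
rewrite exprMn ler_pM2l ?exprn_gt0 ?mulr_gt0//.
rewrite [_ * _ / 2](_ : _ = (1 + x) / (2 * N%:R) * N%:R); last first.
  by field; rewrite pnatr_eq0.
rewrite expRM_natr lerXn2r ?nnegrE ?expR_ge0 ?divr_ge0 ?addr_ge0 ?mulr_ge0//.
by rewrite (le_trans _ (expR_ge1Dx _))// lerDr.
Qed.

(** With [x = 1/d], the quotient of the two powers is [(1 + x)^a]. Since [x^q >= x - 1], the
    exponential is at most [exp (1/2) exp (- x/2)], and the preceding bound applies. *)
Lemma inverse_power_bound (a : R) (q : nat) : (0 < q)%N ->
  exists2 K : R, 0 < K & forall d, 0 < d ->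
    expR (- (1 / 2) * d^-1 ^+ q) * powR d (- a) <= K * powR (1 + d) (- a).
Proof.
move=> q0; have [K K0 KP] := powR_expR_bounded a.
exists (K * expR (1 / 2)) => [|d d0]; first by rewrite mulr_gt0 ?expR_gt0.
have x0 : 0 < d^-1 by rewrite invr_gt0.
have xq : d^-1 - 1 <= d^-1 ^+ q.
  have [x1|x1] := leP d^-1 1.
    by apply: (@le_trans _ _ 0); rewrite ?subr_le0// exprn_ge0// ltW.
  apply: (@le_trans _ _ d^-1); rewrite ?gerBl// ler_eXnr//; exact: ltW.
rewrite !powRN ler_pdivlMr ?powR_gt0 ?addr_gt0// -mulrA.
rewrite [X in _ * X](_ : _ = powR (1 + d^-1) a); last first.
  have pd0 : powR d a != 0 by rewrite gt_eqF ?powR_gt0.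
  apply: (mulfI pd0); rewrite mulVKf// -powRM ?addr_ge0 ?ltW//.
  by rewrite mulrDr mulr1 mulfV ?gt_eqF// addrC.
rewrite mulrC; apply: (@le_trans _ _ (powR (1 + d^-1) a *
    (expR (- (d^-1 / 2)) * expR (1 / 2)))).
  by rewrite ler_wpM2l ?powR_ge0// -expRD ler_expR; lra.
by rewrite mulrA ler_wpM2r ?expR_ge0// KP// ltW.
Qed.

Lemma powR_prod (I : finType) (d : I -> R) (b : R) : (forall i, 0 <= d i) ->
  powR (\prod_i d i) b = \prod_i powR (d i) b.
Proof.
move=> d0; suff [] : 0 <= \prod_i d i /\ powR (\prod_i d i) b = \prod_i powR (d i) b by [].
apply: (big_ind2 (fun x y => 0 <= x /\ powR x b = y)) => [|x1 x2 y1 y2 [? <-] [? <-]|i _].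
- by rewrite powR1.
- by rewrite mulr_ge0// powRM.
- by [].
Qed.

(** Both sides are products over the eigenvalues of [B], so the scalar bound is applied to each of
    them. *)
Lemma integrand_bound (n q : nat) (a : R) : (0 < q)%N ->
  exists2 K : R, 0 < K & forall B : 'M[R]_n, posdef B ->
    expR (- (1 / 2) * \tr (mxpow (invmx B) q)) * powR (\det B) (- a) <=
    K * powR (\det (1%:M + B)) (- a).
Proof.
move=> q0; have [K K0 KP] := inverse_power_bound a q0.
exists (K ^+ n) => [|B pB]; first exact: exprn_gt0.
have [d [d0 -> -> ->]] := posdef_eigenvalues pB.
have d1 i : 0 <= 1 + d i by rewrite addr_ge0// ltW.
rewrite mulr_sumr expR_sum (powR_prod _ d1) powR_prod => [|i]; last exact: ltW.
rewrite -big_split /= (_ : K ^+ n = \prod_(i < n) K); last by rewrite prodr_const card_ord.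
rewrite -big_split /=.
by apply: ler_prod => i _; rewrite mulr_ge0 ?expR_ge0 ?powR_ge0//= KP.
Qed.

End ScalarBounds.

(** * Measurability of determinants, adjugates and the positive definite cone *)

Section Measurability.
Variables (R : realType) (d : measure_display) (T : measurableType d).

Definition mmeas m n (B : T -> 'M[R]_(m, n)) :=
  forall i j, measurable_fun setT (fun t => B t i j).

Lemma mmeas_mul m n p (A : T -> 'M[R]_(m, n)) (B : T -> 'M[R]_(n, p)) :
  mmeas A -> mmeas B -> mmeas (fun t => A t *m B t).
Proof.
move=> mA mB i j; under eq_fun do rewrite mxE.
by apply: measurable_sum => k; exact: measurable_funM.
Qed.

Lemma mmeas_det n (B : T -> 'M[R]_n) : mmeas B ->
  measurable_fun setT (fun t => \det (B t)).
Proof.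
move=> mB; apply: measurable_sum => s; apply: measurable_funM => //.
by apply: measurable_prod => i _.
Qed.

Lemma mmeas_adj n (B : T -> 'M[R]_n) : mmeas B -> mmeas (fun t => \adj (B t)).
Proof.
move=> mB i j; under eq_fun do rewrite mxE /cofactor.
apply: measurable_funM; first exact: measurable_cst.
apply: mmeas_det => k l.
under eq_fun do rewrite !mxE.
exact: mB.
Qed.

Lemma mmeas_posdef n (B : T -> 'M[R]_n) : mmeas B -> (forall t, (B t)^T = B t) ->
  measurable_fun setT (fun t => `[< posdef (B t) >]).
Proof.
elim: n B => [|n ih] B mB sB.
  rewrite (_ : (fun t => _) = cst true); first exact: measurable_cst.
  apply/funext => t; apply/asboolT; split=> [|v]; first exact: sB.
  by case/eqP; apply/matrixP; case.
pose u t := @ursubmx _ 1 n 1 n (B t).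
(* Schur complement of the head entry, with the inverse written as a power: this is measurable on
   the whole line and equals the inverse where the entry is positive. *)
pose S t := @drsubmx _ 1 n 1 n (B t) - powR (B t 0 0) (-1) *: ((u t)^T *m u t).
rewrite (_ : (fun t => _) = (fun t => (0 < B t 0 0) && `[< posdef (S t) >])).
  apply: measurable_and; first exact: measurable_fun_ltr.
  apply: ih => [i j|t].
    rewrite /S; under eq_fun do rewrite !mxE big_ord1 !mxE.
    apply: measurable_funB => //; apply: measurable_funM.
      by apply: (measurableT_comp (f := fun x => powR x (-1))); first exact: measurable_powR.
    exact: measurable_funM.
  by rewrite /S linearB /= trmxZ trmx_mul trmxK trmx_drsub sB.
apply/funext => t; have pE := @posdef_schur_sym _ n _ (sB t).
apply/asboolP/andP => [/pE[b0 pS]|[b0 /asboolP pS]].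
  by split=> //; apply/asboolP; rewrite /S powR_inv1// ltW.
by apply/pE; split=> //; move: pS; rewrite /S powR_inv1// ltW.
Qed.

End Measurability.

(** * Symmetric matrices in coordinates *)

Section SymMatrix.
Variables (R : realType) (n : nat).
Implicit Types (e : 'I_n * 'I_n -> R) (k : 'I_n * 'I_n).

(** Families are indexed by all pairs, but only pairs in increasing order are read, so every family
    yields a symmetric matrix. *)
Definition sort_pair (i j : 'I_n) := if (i <= j)%N then (i, j) else (j, i).

Definition symmx e : 'M[R]_n := \matrix_(i, j) e (sort_pair i j).

Lemma sort_pairC i j : sort_pair i j = sort_pair j i.
Proof. by rewrite /sort_pair; case: ltngtP => // /val_inj ->. Qed.

Lemma symmx_sym e : (symmx e)^T = symmx e.
Proof. by apply/matrixP => i j; rewrite !mxE sort_pairC. Qed.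

Lemma mem_sym_pairs k : (k \in sym_pairs n) = (k.1 <= k.2)%N.
Proof.
rewrite mem_filter andbC; case: k => i j /=.
suff -> : (i, j) \in [seq (i, j) | i <- enum 'I_n, j <- enum 'I_n] by [].
by apply/allpairsP; exists (i, j); rewrite !mem_enum.
Qed.

Lemma uniq_sym_pairs : uniq (sym_pairs n).
Proof.
rewrite filter_uniq// allpairs_uniq ?enum_uniq//.
by move=> [? ?] [? ?].
Qed.

Lemma symmx_upd e k x : (k.1 <= k.2)%N ->
  sym_upd (fun i j => symmx e i j) k x = (fun i j => symmx (upd e k x) i j).
Proof.
case: k => a b /= ab; apply/funext => i; apply/funext => j.
rewrite /sym_upd !mxE /upd /sort_pair /=.
case: (leqP i j) => ij; rewrite xpair_eqE.
  case: (i =P b) ij => [->|_] ij; last by rewrite orbF.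
  case: (j =P a) ij => [->|_] ij; last by rewrite orbF.
  by have -> : a = b by [apply/val_inj/anti_leq; rewrite ab]; rewrite !eqxx.
case: (i =P a) ij => [->|_] ij /=; last by rewrite andbC.
case: (j =P b) ij => [->|_] ij; first by rewrite ltnNge ab in ij.
by rewrite /= andbC.
Qed.

(** [sym_upd] writes two mirrored entries at once, which amounts to a single [upd] at the sorted
    pair. *)
Lemma sym_integralE (F : 'M[R]_n -> \bar R) :
  sym_integral F = iint (sym_pairs n) (F \o symmx) (fun=> 0).
Proof.
rewrite /sym_integral; set env := fun _ _ => 0.
have -> : env = (fun i j => symmx (fun=> 0) i j).
  by apply/funext => i; apply/funext => j; rewrite mxE.
have : {subset sym_pairs n <= sym_pairs n} by [].
elim: {1 3 4}(sym_pairs n) (fun=> 0) => [|k s ih] e sub /=.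
  by congr F; apply/matrixP => i j; rewrite !mxE.
apply: eq_integral => x _; rewrite symmx_upd ?ih//.
  by move=> j js; apply: sub; rewrite inE js orbT.
by rewrite -mem_sym_pairs sub// mem_head.
Qed.

Lemma mmeas_symmx d (T : measurableType d) (f : T -> 'I_n * 'I_n -> R) :
  (forall i, measurable_fun setT (fun t => f t i)) -> mmeas (fun t => symmx (f t)).
Proof. by move=> mf i j; under eq_fun do rewrite mxE; exact: mf. Qed.

Lemma mmeas_scalarD d (T : measurableType d) (c : R) (B : T -> 'M[R]_n) :
  mmeas B -> mmeas (fun t => c%:M + B t).
Proof.
move=> mB i j; under eq_fun do rewrite !mxE.
by apply: measurable_funD => //; exact: measurable_cst.
Qed.

(** Only the values of [g] on the cone count, so [g] may be replaced there by a formula that is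
    measurable everywhere. *)
Lemma emeas_posdef_if (g : 'M[R]_n -> R) :
  (forall d (T : measurableType d) (B : T -> 'M[R]_n), mmeas B ->
    (forall t, (B t)^T = B t) ->
    exists2 h : T -> R, measurable_fun setT h & forall t, posdef (B t) -> g (B t) = h t) ->
  emeas (fun e => if `[< posdef (symmx e) >] then (g (symmx e))%:E else 0%E).
Proof.
move=> mg d T f mf; have mB := mmeas_symmx mf.
have [h mh gh] := mg _ _ _ mB (fun t => symmx_sym (f t)).
rewrite (_ : (fun t => _) = (fun t => if `[< posdef (symmx (f t)) >] then (h t)%:E else 0%E)).
  apply: measurable_fun_ifT; last exact: measurable_cst.
    by apply: mmeas_posdef => // t; exact: symmx_sym.
  exact/measurable_EFinP.
by apply/funext => t; case: asboolP => // /gh ->.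
Qed.

(** Provides a cube inside the cone. For [D = symmx e - 1], the inequality
    [2 |v_i v_j| <= v_i^2 + v_j^2] and the radius [1/(2n)] bound the form of [D] by half of
    [|v|^2]. *)
Lemma posdef_near_id e : (0 < n)%N ->
  (forall k, `|e k - (k.1 == k.2)%:R| < (2 * n%:R)^-1) -> posdef (symmx e).
Proof.
move=> n0 eP; have n0' : 0 < n%:R :> R by rewrite ltr0n.
split; first exact: symmx_sym.
move=> v v0; have := sqnorm_gt0 v0; rewrite sqnormE; set N := \sum_i _ => N0.
pose D := symmx e - 1%:M.
have DP i j : `|D i j| <= (2 * n%:R)^-1.
  rewrite ltW// !mxE; have := eP (sort_pair i j).
  by rewrite /sort_pair; case: (leqP i j) => //= _; rewrite eq_sym.
have -> : symmx e = 1%:M + D by rewrite addrC subrK.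
rewrite mulmxDr mulmxDl mxE mulmx1 sqnormE -/N.
suff : `|(v^T *m D *m v) 0 0| <= N / 2.
  by rewrite ler_norml => /andP[+ _]; lra.
rewrite mxE; apply: (le_trans (ler_norm_sum _ _ _)).
apply: (@le_trans _ _ (\sum_j \sum_i (2 * n%:R)^-1 * ((v i 0 ^+ 2 + v j 0 ^+ 2) / 2))).
  apply: ler_sum => j _; rewrite mxE mulr_suml.
  apply: (le_trans (ler_norm_sum _ _ _)); apply: ler_sum => i _.
  rewrite mxE !normrM mulrAC mulrC ler_pM ?mulr_ge0//.
  rewrite -[v i 0 ^+ 2]real_normK ?num_real// -[v j 0 ^+ 2]real_normK ?num_real//.
  have := sqr_ge0 (`|v i 0| - `|v j 0|); rewrite sqrrB; lra.
under eq_bigr do rewrite -mulr_sumr -mulr_suml big_split /=.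
rewrite -mulr_sumr -mulr_suml big_split /= -/N.
under [X in _ + X]eq_bigr do rewrite sumr_const card_ord.
rewrite sumr_const card_ord sumrMnl -/N.
rewrite -[N *+ n]mulr_natr le_eqVlt; apply/orP; left; apply/eqP; field.
by rewrite gt_eqF.
Qed.

End SymMatrix.

(** * Integrals over lines and vectors *)

Section TailWeight.
Variable R : realType.
Notation mu := (@lebesgue_measure R).

(** An integrable weight used twice: for each coordinate of the vector integral and for the head
    entry in the induction on the size. *)
Definition tail_weight (x : R) := powR (1 + `|x|) (- (3 / 2)).

Lemma tail_weight_ge0 x : 0 <= tail_weight x. Proof. exact: powR_ge0. Qed.

Lemma measurable_tail_weight : measurable_fun [set: R] tail_weight.
Proof.
apply: (measurableT_comp (f := fun x => powR x (- (3 / 2)))).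
  exact: measurable_powR.
by apply: measurable_funD => //; exact: measurableT_comp.
Qed.

Lemma continuous_powR (a x : R) : 0 < x -> {for x, continuous (fun y => powR y a)}.
Proof.
move=> x0; apply/differentiable_continuous/derivable1_diffP.
by apply: derivable_powR; rewrite in_itv /= x0.
Qed.

Lemma integral_powR_tail :
  (\int[mu]_(x in `[1%R, +oo[) (powR x (- (3 / 2)))%:E = 2%:E)%E.
Proof.
rewrite (@ge0_continuous_FTC2y _ _ (fun x => - 2 * powR x (- (1 / 2))) 1 0).
- by rewrite powR1 mulr1 -EFinB sub0r opprK.
- by move=> x _; exact: powR_ge0.
- apply: continuous_in_subspaceT => x /set_mem; rewrite /= in_itv /= andbT => x1.
  by apply: continuous_powR; exact: lt_le_trans x1.
- apply/cvgrPdist_lt => e e0; near=> x.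
  have x0 : 0 < x by near: x; exact: nbhs_pinfty_gt.
  rewrite sub0r normrN mulNr normrN ger0_norm ?mulr_ge0 ?powR_ge0//.
  rewrite powRN mul1r powR12_sqrt ?ltW// ltr_pdivrMr ?sqrtr_gt0//.
  rewrite -ltr_pdivrMl// -[ltLHS]ger0_norm ?mulr_ge0 ?invr_ge0 ?ltW//.
  rewrite -sqrtr_sqr ltr_sqrt//.
  by near: x; apply: nbhs_pinfty_gt; rewrite num_real.
- move=> x x1; apply: derivableM => //; apply: derivable_powR.
  by rewrite in_itv /= andbT; exact: lt_trans x1.
- apply: cvgM; first exact: cvg_cst.
  by apply: cvg_at_right_filter; exact: continuous_powR.
- move=> x; rewrite in_itv /= andbT => x1.
  have x0 : 0 < x by exact: lt_trans x1.
  have dx := @is_derive1_powR R (- (1 / 2)) x x0.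
  rewrite derive1E deriveM//= ?derive_val//.
  rewrite [X in _ + X]scaler0 addr0 (_ : - (1 / 2) - 1 = - (3 / 2)); last by field.
  by rewrite /GRing.scale /= mulrA (_ : -2 * - (1 / 2) = 1) ?mul1r//; field.
Unshelve. all: by end_near. Qed.

Lemma integral_tail_weight_fin : (\int[mu]_(x in setT) (tail_weight x)%:E < +oo)%E.
Proof.
(* The power on [[1, +oo[], extended by zero; [g (1 + x)] and [g (1 - x)] together dominate the
   weight on the two half-lines. *)
pose g (y : R) : \bar R := ((fun x => (powR x (- (3 / 2)))%:E) \_ `[1, +oo[%classic) y.
have mg : measurable_fun [set: R] g.
  apply/(measurable_restrictT _ _).1 => //.
  apply/measurable_EFinP; apply: measurable_funTS; exact: measurable_powR.
have g0 y : (0 <= g y)%E by rewrite /g patchE; case: ifP => // _; rewrite lee_fin powR_ge0.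
have ig : (\int[mu]_(x in setT) g x = 2%:E)%E.
  by rewrite -integral_powR_tail [RHS]integral_mkcond.
have maff (l : R) : measurable_fun [set: R] (fun x => g (l * x + 1)).
  by apply: (measurableT_comp mg); apply: measurable_funD => //; exact: measurable_funM.
apply: (@le_lt_trans _ _ (\int[mu]_(x in setT) (g (1 * x + 1)%R + g (-1 * x + 1)%R))%E).
  apply: ge0_le_integral => //.
  - by move=> x _; rewrite lee_fin tail_weight_ge0.
  - by apply/measurable_EFinP; exact: measurable_tail_weight.
  - exact: (emeasurable_funD (maff 1) (maff (-1))).
  move=> x _; rewrite mul1r mulN1r /tail_weight.
  have [x0|x0] := leP 0 x.
    rewrite ger0_norm// addrC (_ : _%:E = g (x + 1)) ?leeDl//.
    by rewrite /g patchE mem_set// /= in_itv /= andbT lerDr.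
  rewrite ltr0_norm// addrC (_ : _%:E = g (- x + 1)) ?leeDr//.
  by rewrite /g patchE mem_set// /= in_itv /= andbT lerDr oppr_ge0 ltW.
rewrite ge0_integralD//; [|exact: maff|exact: maff].
rewrite (ge0_integral_affine 1 (oner_neq0 _) mg g0).
rewrite (ge0_integral_affine 1 (_ : -1 != 0) mg g0) ?oppr_eq0 ?oner_eq0// ig.
by rewrite -!EFinM -EFinD ltry.
Qed.

End TailWeight.

Section VectorIntegral.
Variables (R : realType) (n : nat).
Implicit Types (v : 'I_n -> R).

Definition colf v : 'cV[R]_n := \col_i v i.

(** [N^(-a) <= N^(-n)], and one factor [1/N] is spent on each coordinate: [(1 + |v_i|)^(3/2) <= (1 +
    |v_i|)^2 <= 2 (1 + v_i^2) <= 2 N]. *)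
Lemma vector_integrand_le (a : R) (v : 'I_n -> R) : n%:R <= a ->
  powR (1 + \sum_i v i ^+ 2) (- a) <= 2 ^+ n * \prod_i tail_weight (v i).
Proof.
move=> na; set N := 1 + _.
have s0 : 0 <= \sum_i v i ^+ 2 by rewrite sumr_ge0// => i _; exact: sqr_ge0.
have N1 : 1 <= N by rewrite lerDl.
have N0 : 0 < N by exact: lt_le_trans N1.
rewrite (le_trans (ler_powR N1 (_ : _ <= - n%:R))) ?lerN2// powR_invn ?(ltW N0)//.
have -> : 2 ^+ n * \prod_i tail_weight (v i) = \prod_i (2 * tail_weight (v i)).
  by rewrite big_split /= prodr_const card_ord.
have -> : N ^- n = \prod_(i < n) N^-1 by rewrite prodr_const card_ord exprVn.
apply: ler_prod => i _; rewrite invr_ge0 (ltW N0)/=.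
rewrite /tail_weight powRN ler_pdivlMr ?powR_gt0 ?ltr_pwDl//.
rewrite mulrC ler_pdivrMr//.
apply: (@le_trans _ _ ((1 + `|v i|) ^+ 2)).
  rewrite -powR_mulrn ?addr_ge0// ler_powR ?lerDl//; lra.
have viN : 1 + `|v i| ^+ 2 <= N.
  rewrite lerD2l real_normK ?num_real// (bigD1 i)//= lerDl.
  by rewrite sumr_ge0// => j _; exact: sqr_ge0.
have := sqr_ge0 (1 - `|v i|); move: viN; rewrite !sqrrB !sqrrD; lra.
Qed.

Lemma vector_integral_bounded (a : R) : n%:R <= a ->
  exists2 C : R, 0 <= C & forall e,
    (iint (enum 'I_n) (fun v => (powR (1 + \sum_i v i ^+ 2) (- a))%:E) e <= C%:E)%E.
Proof.
move=> na; pose K := fine (\int[@lebesgue_measure R]_(x in setT) (tail_weight x)%:E)%E.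
have K0 : (0 <= \int[@lebesgue_measure R]_(x in setT) (tail_weight x)%:E)%E.
  by apply: integral_ge0 => x _; rewrite lee_fin tail_weight_ge0.
have KE : (\int[@lebesgue_measure R]_(x in setT) (tail_weight x)%:E)%E = K%:E.
  by rewrite fineK// ge0_fin_numE//; exact: integral_tail_weight_fin.
exists (2 ^+ n * K ^+ n) => [|e]; first by rewrite mulr_ge0 ?exprn_ge0// -lee_fin -KE.
have mprod : emeas (fun v => (\prod_(i <- enum 'I_n) tail_weight (v i))%:E).
  move=> d T f mf; apply/measurable_EFinP; apply: measurable_prod => i _.
  by apply: measurableT_comp => //; exact: measurable_tail_weight.
have prod0 (v : 'I_n -> R) : (0 <= (\prod_(i <- enum 'I_n) tail_weight (v i))%:E)%E.
  by rewrite lee_fin prodr_ge0// => i _; exact: tail_weight_ge0.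
apply: (@le_trans _ _ (iint (enum 'I_n)
    (fun v => (2 ^+ n)%:E * (\prod_(i <- enum 'I_n) tail_weight (v i))%:E) e)%E).
  apply: iint_le.
  - move=> d T f mf; apply/measurable_EFinP.
    apply: (measurableT_comp (f := fun x => powR x (- a))); first exact: measurable_powR.
    apply: measurable_funD => //; apply: measurable_sum => i.
    exact: measurable_funX.
  - by move=> d T f mf; apply: emeasurable_funM => //; exact: mprod.
  - by move=> v; rewrite lee_fin powR_ge0.
  - by move=> v; rewrite -EFinM lee_fin big_enum vector_integrand_le.
rewrite iint_scale ?exprn_ge0// iint_prod ?enum_uniq//; last 2 first.
- exact: measurable_tail_weight.
- exact: tail_weight_ge0.
by rewrite KE big_enum /= prodEFin prodr_const card_ord.
Qed.

(** With [A = L L^T] and [w = t^(-1/2) L^(-1) v], the determinant becomes [det A (1 + |w|^2)], and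
    the remaining integral in [w] is bounded independently of [A] and [t]. *)
Lemma rank1_integral_bounded (a : R) : n%:R <= a ->
  exists2 C : R, 0 <= C & forall (A : 'M[R]_n) (t : R), posdef A -> 0 < t ->
    forall e, (iint (enum 'I_n) (fun v =>
      (powR (\det (A + t^-1 *: (colf v *m (colf v)^T))) (- a))%:E) e <=
    (C * Num.sqrt t ^+ n * powR (\det A) (1 / 2 - a))%:E)%E.
Proof.
move=> na; have [C C0 CP] := vector_integral_bounded na.
exists C => // A t pA t0 e.
have [L [tL L0 AE]] := cholesky pA.
have [tLi Lid] := trig_invmx tL L0.
have dL0 := trig_det_gt0 tL L0.
have uL : L \in unitmx by rewrite unitmxE unitfE gt_eqF.
have st0 : 0 < Num.sqrt t by rewrite sqrtr_gt0.
pose M : 'M[R]_n := (Num.sqrt t)^-1 *: invmx L.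
pose phi v i := (M *m colf v) i 0.
have phiE v i : phi v i = \sum_j M i j * v j.
  by rewrite /phi mxE; apply: eq_bigr => j _; rewrite [colf v _ _]mxE.
have detE v : \det (A + t^-1 *: (colf v *m (colf v)^T)) =
    \det A * (1 + \sum_i phi v i ^+ 2).
  rewrite -(det_rank1_update (M *m colf v)) {1}AE.
  suff : L *m L^T + t^-1 *: (colf v *m (colf v)^T) =
      L *m (1%:M + (M *m colf v) *m (M *m colf v)^T) *m L^T.
    by move=> ->; rewrite !det_mulmx [in RHS]AE det_mulmx mulrAC.
  rewrite mulmxDr mulmxDl mulmx1; congr (_ + _).
  rewrite trmx_mul /M trmxZ !mulmxA -!scalemxAr -!scalemxAl mulmxV// mul1mx.
  rewrite -!mulmxA -trmx_mul mulmxV// trmx1 mulmx1.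
  by rewrite scalerA -invfM -expr2 sqr_sqrtr// ltW.
pose F v : \bar R := ((powR (\det A) (- a))%:E *
  (powR (1 + \sum_i v i ^+ 2)%R (- a))%:E)%E.
have m1 : emeas (fun v : 'I_n -> R => (powR (1 + \sum_i v i ^+ 2) (- a))%:E).
  move=> d T f mf; apply/measurable_EFinP.
  apply: (measurableT_comp (f := fun x => powR x (- a))); first exact: measurable_powR.
  apply: measurable_funD => //; apply: measurable_sum => i.
  exact: measurable_funX.
have mF : emeas F.
  by move=> d T f mf; apply: emeasurable_funM => //; exact: m1.
have F0 v : (0 <= F v)%E by rewrite mule_ge0// lee_fin powR_ge0.
rewrite (_ : (fun v => _) = F \o phi); last first.
  apply/funext => v /=; rewrite detE powRM ?EFinM// ?(ltW (posdef_det_gt0 pA))//.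
  by rewrite addr_ge0// sumr_ge0// => i _; exact: sqr_ge0.
have MP (i j : 'I_n) : (i < j)%N -> M i j = 0.
  by move=> ij; rewrite mxE (is_trig_mxP tLi)// mulr0.
(* [M] is lower triangular, so [phi v j] depends on [v k] only for [k <= j], and the index itself is
   the key. *)
rewrite (@iint_triangular _ _ phi (fun i => M i i) val)//; first last.
- move=> d T f mf; apply: mF => i; under eq_fun do rewrite phiE.
  by apply: measurable_sum => j; apply: measurable_funM.
- move=> i _ v x j ji; rewrite mem_enum /= => ji'; rewrite !phiE.
  apply: eq_bigr => k _; rewrite /upd; case: eqP => // ->.
  by rewrite MP ?mul0r// ltn_neqAle ji' andbT.
- move=> i _ v; exists (\sum_(j | j != i) M i j * v j) => x.
  rewrite phiE (bigD1 i)//= updii; congr (_ + _).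
  by apply: eq_bigr => j ji; rewrite upd_neq.
- by move=> i _; rewrite mxE Lid mulf_neq0// invr_eq0 gt_eqF.
- exact: enum_uniq.
have -> : \prod_(i <- enum 'I_n) `|M i i|^-1 = Num.sqrt t ^+ n * \det L.
  rewrite big_enum /= det_trig//.
  rewrite (_ : Num.sqrt t ^+ n = \prod_(i < n) Num.sqrt t); last first.
    by rewrite prodr_const card_ord.
  rewrite -big_split /=; apply: eq_bigr => i _.
  by rewrite mxE Lid -invfM gtr0_norm ?invr_gt0 ?mulr_gt0// invrK.
rewrite iint_scale ?powR_ge0//; last by move=> v; rewrite lee_fin powR_ge0.
(* [\det L] is the square root of [\det A], whence the half power gained. *)
have -> : (C * Num.sqrt t ^+ n * powR (\det A) (1 / 2 - a))%:E =
    ((Num.sqrt t ^+ n * \det L)%:E * ((powR (\det A) (- a))%:E * C%:E))%E.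
  rewrite -!EFinM; congr (_%:E); rewrite powRD ?(gt_eqF (posdef_det_gt0 pA)) ?implybT//.
  rewrite mul1r powR12_sqrt ?(ltW (posdef_det_gt0 pA))//.
  rewrite {1}AE det_mulmx det_tr -expr2 sqrtr_sqr gtr0_norm//; ring.
apply: lee_wpmul2l; first by rewrite lee_fin mulr_ge0 ?exprn_ge0// ltW.
by apply: lee_wpmul2l; [rewrite lee_fin powR_ge0|exact: CP].
Qed.

End VectorIntegral.

(** * The integral over the cone *)

Section ConeIntegral.
Variable R : realType.
Local Notation env n := ('I_n * 'I_n -> R).

Definition cone_integrand n (a : R) (e : env n) : \bar R :=
  if `[< posdef (symmx e) >] then (powR (\det (1%:M + symmx e)) (- a))%:E else 0%E.

Lemma cone_integrand_ge0 n a (e : env n) : (0 <= cone_integrand a e)%E.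
Proof. by rewrite /cone_integrand; case: ifP => // _; rewrite lee_fin powR_ge0. Qed.

Lemma emeas_cone_integrand n a : emeas (@cone_integrand n a).
Proof.
apply: (@emeas_posdef_if R n (fun B => powR (\det (1%:M + B)) (- a))) => d T B mB sB.
exists (fun t => powR (\det (1%:M + B t)) (- a)) => //.
apply: (measurableT_comp (f := fun x => powR x (- a))); first exact: measurable_powR.
exact/mmeas_det/mmeas_scalarD.
Qed.

Lemma iint0 (I : eqType) (s : seq I) (F : (I -> R) -> \bar R) e :
  (forall e1, (forall i, i \notin s -> e1 i = e i) -> F e1 = 0%E) ->
  iint s F e = 0%E.
Proof.
move=> F0; rewrite (@eq_iint _ _ s F (fun=> 0%E) e e)//.
by elim: s e {F0} => //= i s ih e; under eq_integral do rewrite ih; exact: integral0.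
Qed.

Section Step.
Variable n : nat.
Implicit Types (e : env (1 + n)).

(** Positions in block form: the head entry [b], the rest [u] of the first row, and the lower
    block. *)
Let head : 'I_(1 + n) * 'I_(1 + n) := (lshift n ord0, lshift n ord0).
Let top (j : 'I_n) : 'I_(1 + n) * 'I_(1 + n) := (lshift n ord0, rshift 1 j).
Let low (k : 'I_n * 'I_n) : 'I_(1 + n) * 'I_(1 + n) := (rshift 1 k.1, rshift 1 k.2).

Let top_row e : 'I_n -> R := fun j => e (top j).

Let symmx_block e : symmx e =
  block_mx (e head)%:M (colf (top_row e))^T (colf (top_row e)) (symmx (e \o low)).
Proof.
rewrite (sym_blockK (symmx_sym e)); congr block_mx.
- by congr (_%:M); rewrite mxE /sort_pair leqnn; congr e; congr pair; exact: val_inj.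
- by apply/rowP => j; rewrite !mxE.
- by apply/colP => j; rewrite !mxE.
- apply/matrixP => i j; rewrite !mxE /= /low /sort_pair /=.
  by rewrite leq_add2l; case: ifP.
Qed.

(** The first row is placed innermost, to be integrated out while [b] and the lower block are
    fixed. *)
Let sym_pairs_perm : perm_eq (sym_pairs (1 + n))
  ((head :: map low (sym_pairs n)) ++ map top (enum 'I_n)).
Proof.
apply: uniq_perm; first exact: uniq_sym_pairs.
  rewrite /= mem_cat negb_or -!andbA cat_uniq; apply/and5P; split.
  - by apply/mapP => -[k _] [/eqP].
  - by apply/mapP => -[k _] [/eqP].
  - rewrite map_inj_uniq ?uniq_sym_pairs//.
    by move=> [i j] [i' j'] /= [/addnI/val_inj -> /addnI/val_inj ->].
  - by apply/hasPn => k /mapP[j _ ->]; apply/mapP => -[k' _] [/eqP].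
  - by rewrite map_inj_uniq ?enum_uniq// => j j' [] /addnI/val_inj.
move=> [i j]; rewrite mem_sym_pairs /= inE mem_cat.
have rl (i1 : 'I_n) : (rshift 1 i1 == lshift n ord0) = false.
  by rewrite eq_sym eq_lrshift.
have [i' -> | i' ->] := split_ordP i; have [j' -> | j' ->] := split_ordP j.
- by rewrite !ord1 leqnn /head eqxx.
- rewrite ord1; transitivity true => //; apply/esym/orP; right; apply/orP; right.
  by apply/mapP; exists j'; rewrite ?mem_enum.
- rewrite ord1; transitivity false => //; apply/esym/negbTE; rewrite !negb_or.
  apply/and3P; split; first by rewrite xpair_eqE rl.
    by apply/mapP => -[k _] [_ /eqP].
  by apply/mapP => -[k _] [/eqP].
rewrite xpair_eqE rl /= leq_add2l -[LHS]orbF; congr (_ || _).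
  apply/idP/mapP => [ij|[[i2 j2]]]; first by exists (i', j'); rewrite ?mem_sym_pairs.
  by rewrite mem_sym_pairs /= => ij [/addnI/val_inj -> /addnI/val_inj ->].
by apply/esym/negbTE/mapP => -[k _] [/eqP].
Qed.

(* [B' = S + u u^T / b]; the inverse is written as a power so that it is
   measurable on the whole line. *)
Let shear e : env (1 + n) := fun k =>
  if (0 < k.1)%N && (k.1 <= k.2)%N then
    e k + powR (e head) (-1) * (e (lshift n ord0, k.1) * e (lshift n ord0, k.2))
  else e k.

Let shear_head e : shear e head = e head. Proof. by []. Qed.

Let shear_top e : top_row (shear e) = top_row e. Proof. by []. Qed.

Let shear_low e : symmx (shear e \o low) =
  symmx (e \o low) + powR (e head) (-1) *: (colf (top_row e) *m (colf (top_row e))^T).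
Proof.
apply/matrixP => i j; rewrite !mxE big_ord1 !mxE /shear /= /low /sort_pair /=.
by case: (leqP i j) => ij /=; rewrite leq_add2l ?ij ?(ltnW ij)//= [X in _ = _ + _ * X]mulrC.
Qed.

Let sheared a e : \bar R :=
  if (0 < e head) && `[< posdef (symmx (e \o low)) >] then
    (powR (1 + e head) (- a) * powR (\det ((1%:M + symmx (e \o low)) +
      (e head * (1 + e head))^-1 *: (colf (top_row e) *m (colf (top_row e))^T))) (- a))%:E
  else 0%E.

(** The Schur complement of the sheared matrix is [S]. Adding the identity changes the head to
    [1 + b], and the rank-one terms combine by [1/b - 1/(1 + b) = 1/(b (1 + b))]. *)
Let cone_integrand_shear a e : cone_integrand a (shear e) = sheared a e.
Proof.
rewrite /cone_integrand /sheared symmx_block shear_head shear_top shear_low.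
set b := e head; set S := symmx _; set v := colf _.
have [b0|b0] /= := ltP 0 b; last first.
  by case: asboolP => // pB; have := @posdef_head R n b v^T _; rewrite trmxK ltNge b0 => /(_ _ pB).
have E : posdef (block_mx b%:M v^T v (S + powR b (-1) *: (v *m v^T))) <-> posdef S.
  have := @posdef_schurE R n b v^T (S + powR b (-1) *: (v *m v^T)); rewrite trmxK => ->.
  by rewrite powR_inv1 ?(ltW b0)// addrK; split=> [[]|].
rewrite (asbool_equiv_eq E); case: asboolP => // pS.
have b1 : 0 < 1 + b by rewrite addr_gt0.
rewrite -powRM ?(ltW b1)//; last first.
  apply/ltW/posdef_det_gt0/posdefD_rank1; first by rewrite invr_ge0 mulr_ge0 ?ltW.
  exact: posdefD_scalar.
congr (powR _ _)%:E.
have -> : 1%:M + block_mx b%:M v^T v (S + powR b (-1) *: (v *m v^T)) =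
    block_mx (1 + b)%:M v^T (v^T)^T (1%:M + (S + powR b (-1) *: (v *m v^T))).
  by rewrite scalar_mx_block add_block_mx !add0r trmxK raddfD.
rewrite det_schur ?gt_eqF// trmxK -!addrA; congr (_ * \det (_ + (_ + _))).
rewrite powR_inv1 ?(ltW b0)// -scalerBl; congr (_ *: _).
by field; rewrite !gt_eqF.
Qed.

Let measurable_shear d (T : measurableType d) (f : T -> env (1 + n)) k :
  (forall i, measurable_fun setT (fun t => f t i)) ->
  measurable_fun setT (fun t => shear (f t) k).
Proof.
move=> mf; rewrite /shear; case: (_ && _) => //.
apply: measurable_funD; first exact: mf.
apply: measurable_funM; last exact: (measurable_funM (mf _) (mf _)).
by apply: (measurableT_comp (f := fun x => powR x (-1))); first exact: measurable_powR.
Qed.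

Let sheared_ge0 a e : (0 <= sheared a e)%E.
Proof. by rewrite -cone_integrand_shear cone_integrand_ge0. Qed.

Let emeas_sheared a : emeas (sheared a).
Proof.
rewrite (_ : sheared a = cone_integrand a \o shear); last first.
  by apply/funext => e /=; rewrite cone_integrand_shear.
move=> d T f mf; apply: (@emeas_cone_integrand _ a _ T (fun t => shear (f t))) => k.
exact: measurable_shear.
Qed.

(** The shear has diagonal coefficients 1 and moves only the lower block, by an amount depending on
    the first row; keys 0 and 1 separate the two. *)
Let iint_shear a e : iint (sym_pairs (1 + n)) (cone_integrand a) e =
  iint (sym_pairs (1 + n)) (sheared a) e.
Proof.
have -> : sheared a = cone_integrand a \o shear.
  by apply/funext => e' /=; rewrite cone_integrand_shear.
rewrite [RHS](@iint_triangular R _ shear (fun=> 1) (fun k => (0 < k.1)%N : nat)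
  _ (cone_integrand a)).
- rewrite big1 ?mul1e => [|k _]; last by rewrite normr1 invr1.
  apply: eq_iint => // k; rewrite mem_sym_pairs /shear => /negbTE ->.
  by rewrite andbF.
- exact: emeas_cone_integrand.
- exact: cone_integrand_ge0.
- exact: uniq_sym_pairs.
- by move=> k _; rewrite oner_neq0.
- move=> k _ e'; rewrite /shear.
  case: (boolP ((0 < k.1)%N && (k.1 <= k.2)%N)) => [/andP[k1 k2]|_].
    exists (powR (e' head) (-1) * (e' (lshift n ord0, k.1) * e' (lshift n ord0, k.2))) => x.
    have neq j : ((lshift n ord0, j) == k) = false.
      by apply/negbTE; apply: contraTneq k1 => <-.
    by rewrite updii /upd !neq mul1r.
  by exists 0 => x; rewrite updii mul1r addr0.
- move=> k ks e' x j jk; rewrite mem_sym_pairs /shear.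
  case: ifP => [/andP[j1 j2]|_ _]; last by rewrite upd_neq.
  rewrite j2 j1 /= => k1.
  have neq i : ((lshift n ord0, i) == k) = false.
    by apply/negbTE; apply: contraTneq k1 => <-.
  by rewrite /upd !neq (negbTE jk).
- move=> d T f mf; apply: (@emeas_cone_integrand _ a _ T (fun t => shear (f t))) => k.
  exact: measurable_shear.
Qed.

(** [sqrt (b (1 + b)) <= 1 + b], so the total exponent is [n - a <= - 3/2]. *)
Let head_factor (a b : R) : n.+1%:R + 1 / 2 <= a -> 0 < b ->
  powR (1 + b) (- a) * Num.sqrt (b * (1 + b)) ^+ n <= tail_weight b.
Proof.
move=> na b0; have b1 : 0 < 1 + b by rewrite addr_gt0.
have sb : Num.sqrt (b * (1 + b)) <= 1 + b.
  rewrite -[leRHS]ger0_norm ?(ltW b1)// -sqrtr_sqr ler_wsqrtr//.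
  by rewrite expr2 ler_wpM2r ?(ltW b1)// lerDr.
apply: (@le_trans _ _ (powR (1 + b) (- a) * (1 + b) ^+ n)).
  by rewrite ler_wpM2l ?powR_ge0// lerXn2r ?nnegrE ?sqrtr_ge0 ?(ltW b1).
rewrite -powR_mulrn ?(ltW b1)// -powRD ?(gt_eqF b1) ?implybT//.
rewrite /tail_weight ger0_norm ?(ltW b0)// ler_powR ?lerDl ?(ltW b0)//.
by move: na; rewrite -natr1; lra.
Qed.

Let iint_top_bounded a : n.+1%:R + 1 / 2 <= a ->
  exists2 C : R, 0 <= C & forall e,
    (iint (map top (enum 'I_n)) (sheared a) e <=
     (C * tail_weight (e head))%:E * cone_integrand (a - 1 / 2) (e \o low))%E.
Proof.
move=> na; have [|C C0 CP] := @rank1_integral_bounded R n a.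
  by move: na; rewrite -natr1; lra.
exists C => // e; set b := e head; set S := symmx (e \o low).
have top_head : head \notin map top (enum 'I_n) by apply/mapP => -[k _] [].
have top_low k : low k \notin map top (enum 'I_n) by apply/mapP => -[j _] [].
have [/andP[b0 /asboolP pS]|cond] := boolP ((0 < b) && `[< posdef S >]); last first.
  rewrite iint0 => [|e1 e1P].
    by rewrite mule_ge0 ?cone_integrand_ge0// lee_fin mulr_ge0 ?tail_weight_ge0.
  rewrite /sheared e1P// -/b (_ : e1 \o low = e \o low) ?(negbTE cond)//.
  by apply/funext => k /=; rewrite e1P.
set t := b * (1 + b); have t0 : 0 < t by rewrite mulr_gt0 ?addr_gt0.
pose A := 1%:M + S; have pA : posdef A by exact: posdefD_scalar.
pose G (v : 'I_n -> R) : \bar R :=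
  ((powR (\det (A + t^-1 *: (colf v *m (colf v)^T))) (- a))%:E)%E.
have G0 v : (0 <= G v)%E by rewrite lee_fin powR_ge0.
have mG : emeas G.
  move=> d T f mf; apply/measurable_EFinP.
  apply: (measurableT_comp (f := fun x => powR x (- a))); first exact: measurable_powR.
  apply: mmeas_det => i j; under eq_fun do rewrite !mxE big_ord1 !mxE.
  by apply: measurable_funD => //; apply: measurable_funM => //; apply: measurable_funM.
have -> : iint (map top (enum 'I_n)) (sheared a) e =
    iint (enum 'I_n) (fun v => (powR (1 + b) (- a))%:E * G v)%E (top_row e).
  (* The relation says that the head and the lower block stay fixed while the first row follows
     [v]. *)
  apply: (@iint_simul R _ _ top _ _ _ (fun e1 v =>
    [/\ e1 head = b, e1 \o low = e \o low & top_row e1 = v])) => //.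
    move=> e1 v j x _ [e1h e1l <-]; split.
    - by rewrite upd_neq.
    - by rewrite -e1l; apply/funext => k /=; rewrite upd_neq.
    - apply/funext => i; rewrite /top_row /upd.
      have [->|ij] := eqVneq i j; first by rewrite eqxx.
      by case: eqP => // -[] /addnI/val_inj /eqP; rewrite (negbTE ij).
  move=> e1 v [e1h e1l e1v].
  rewrite /sheared e1h e1l -/S b0 e1v /=.
  by case: asboolP => // _; rewrite EFinM.
rewrite iint_scale ?powR_ge0//.
apply: (@le_trans _ _ ((powR (1 + b) (- a))%:E *
    (C * Num.sqrt t ^+ n * powR (\det A) (1 / 2 - a))%:E)%E).
  by rewrite lee_wpmul2l ?CP// lee_fin powR_ge0.
rewrite /cone_integrand -/S; case: asboolP => // _.
rewrite -!EFinM lee_fin -/A opprB !mulrA ler_wpM2r ?powR_ge0//.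
by rewrite [_ * C]mulrC -mulrA ler_wpM2l// head_factor.
Qed.

(** Once the first row is integrated out, the bound is a function of [b] times a function of the
    lower block, so the integral splits. *)
Lemma cone_integral_step (a : R) : n.+1%:R + 1 / 2 <= a ->
  (forall e : env n, iint (sym_pairs n) (cone_integrand (a - 1 / 2)) e < +oo)%E ->
  forall e, (iint (sym_pairs (1 + n)) (cone_integrand a) e < +oo)%E.
Proof.
move=> na ih e; have [C C0 CP] := iint_top_bounded na.
rewrite iint_shear (iint_perm _ _ _ sym_pairs_perm)//.
rewrite iint_cat.
have mlow : emeas (fun e1 : env (1 + n) => cone_integrand (a - 1 / 2) (e1 \o low)).
  move=> d T f mf; apply: (@emeas_cone_integrand _ (a - 1 / 2) _ T (fun t => f t \o low)) => k.
  exact: mf.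
have mk : measurable_fun [set: R] (fun x => C * tail_weight x).
  by apply: measurable_funM => //; exact: measurable_tail_weight.
have k0 x : 0 <= C * tail_weight x by rewrite mulr_ge0 ?tail_weight_ge0.
apply: (@le_lt_trans _ _ (iint (head :: map low (sym_pairs n)) (fun e1 =>
    (C * tail_weight (e1 head))%:E * cone_integrand (a - 1 / 2) (e1 \o low))%E e)).
  apply: iint_le => //.
  - exact: emeas_iint.
  - move=> d T f mf; apply: emeasurable_funM; last exact: mlow.
    by apply/measurable_EFinP; exact: (measurableT_comp mk).
  - by move=> e1; exact: iint_ge0.
rewrite /=; set J := iint (sym_pairs n) (cone_integrand (a - 1 / 2)) (e \o low).
have JE x : iint (map low (sym_pairs n)) (fun e1 =>
    (C * tail_weight (e1 head))%:E * cone_integrand (a - 1 / 2) (e1 \o low))%E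
    (upd e head x) = ((C * tail_weight x)%:E * J)%E.
  rewrite (@iint_scale_dep _ _ _ _ (fun e1 => C * tail_weight (e1 head)))//; first last.
  - by move=> e1 ->//; apply/mapP => -[k _] [].
  - by move=> e1; exact: cone_integrand_ge0.
  rewrite updii; congr (_ * _)%E.
  apply: (@iint_simul R _ _ low _ _ _ (fun e1 v => e1 \o low = v)).
  - move=> e1 v [i j] x' _ <-; apply/funext => -[i' j'] /=.
    rewrite /upd /low /= !xpair_eqE; by rewrite !eq_rshift.
  - by move=> e1 v ->.
  - by apply/funext => k /=; rewrite upd_neq.
under eq_integral do rewrite JE.
have J0 : (0 <= J)%E by apply: iint_ge0; exact: cone_integrand_ge0.
rewrite ge0_integralZr//; last 2 first.
- exact/measurable_EFinP.
- by move=> x _; rewrite lee_fin.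
under eq_integral do rewrite EFinM.
rewrite ge0_integralZl_EFin//; last 2 first.
- by move=> x _; rewrite lee_fin tail_weight_ge0.
- by apply/measurable_EFinP; exact: measurable_tail_weight.
have K0 : (0 <= \int[@lebesgue_measure R]_(x in setT) (tail_weight x)%:E)%E.
  by apply: integral_ge0 => x _; rewrite lee_fin tail_weight_ge0.
apply: lte_mul_pinfty; last exact: ih.
- by rewrite mule_ge0.
- by rewrite fin_numM// ge0_fin_numE//; exact: integral_tail_weight_fin.
Qed.
End Step.

(** Lowering the size by one lowers the threshold by 1 but the exponent only by 1/2, so the
    hypothesis persists. *)
Lemma cone_integral_fin n (a : R) (e : env n) : n%:R + 1 / 2 <= a ->
  (iint (sym_pairs n) (cone_integrand a) e < +oo)%E.
Proof.
elim: n a e => [|n ih] a e na.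
  (* In size 0 there is nothing to integrate, and the integral is a single finite value. *)
  have -> : sym_pairs 0 = [::].
    by apply/eqP; rewrite -size_eq0 -leqn0 leqNgt -has_predT; apply/hasPn => - [[]].
  by rewrite /= /cone_integrand; case: ifP => _; rewrite ltry.
apply: (@cone_integral_step n a na) => e'; apply: ih.
by move: na; rewrite -natr1; lra.
Qed.

End ConeIntegral.

(** * Change of variables by congruence *)

Section Congruence.
Variables (R : realType) (n : nat) (M : 'M[R]_n).
Hypotheses (tM : is_trig_mx M) (M0 : forall i, 0 < M i i).
Local Notation env := ('I_n * 'I_n -> R).

Let congr_env (e : env) : env := fun k =>
  if (k.1 <= k.2)%N then (M *m symmx e *m M^T) k.1 k.2 else e k.

Let symmx_congr e : symmx (congr_env e) = M *m symmx e *m M^T.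
Proof.
have sX : (M *m symmx e *m M^T)^T = M *m symmx e *m M^T.
  by rewrite !trmx_mul trmxK symmx_sym mulmxA.
apply/matrixP => i j; rewrite mxE /sort_pair /congr_env.
case: (leqP i j) => /= ij; first by rewrite ij.
by rewrite (ltnW ij) -[in LHS]sX mxE.
Qed.

Let unit_env (k0 : 'I_n * 'I_n) : env := fun k => (k == k0)%:R.

Let symmx_upd_unit e k0 x :
  symmx (upd e k0 x) = symmx e + (x - e k0) *: symmx (unit_env k0).
Proof.
apply/matrixP => i j; rewrite !mxE /upd /unit_env.
by case: eqP => [->|_]; rewrite ?mulr1 ?mulr0 ?addr0// addrC subrK.
Qed.

(** A nonzero term needs [l <= a] and [k <= b] as [M] is lower triangular, while
    [l + k = i0 + j0 >= a + b]; hence [l = a] and [k = b]. *)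
Let congr_unit_env (k0 k : 'I_n * 'I_n) : (k0.1 <= k0.2)%N -> (k.1 <= k.2)%N ->
  (k.1 + k.2 <= k0.1 + k0.2)%N ->
  (M *m symmx (unit_env k0) *m M^T) k.1 k.2 = (k == k0)%:R * (M k.1 k.1 * M k.2 k.2).
Proof.
case: k0 => i0 j0; case: k => a b /= ij0 ab le_ab.
have zero (l k : 'I_n) : (l, k) != (a, b) ->
    M a l * symmx (unit_env (i0, j0)) l k * M b k = 0.
  move=> lk; have [la|al] := leqP l a; last by rewrite (is_trig_mxP tM)// !mul0r.
  have [kb|bk] := leqP k b; last first.
    by rewrite [M b k](is_trig_mxP tM)// mulr0.
  rewrite mxE /unit_env; case: eqP => [E|_]; last by rewrite mulr0 mul0r.
  have lkE : (l + k = i0 + j0)%N.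
    by move: E; rewrite /sort_pair; case: leqP => _ [-> ->]; rewrite // addnC.
  have la' : l = a by apply/val_inj/eqP; rewrite /= eqn_leq la /=; lia.
  have kb' : k = b by apply/val_inj/eqP; rewrite /= eqn_leq kb /=; lia.
  by rewrite la' kb' eqxx in lk.
rewrite mxE (bigD1 b)//= [X in _ + X]big1 => [|k kb]; last first.
  rewrite mxE mulr_suml big1// => l _; rewrite [M^T _ _]mxE zero//.
  by rewrite xpair_eqE (negbTE kb) andbF.
rewrite addr0 mxE mulr_suml (bigD1 a)//= [X in _ + X]big1 => [|l la]; last first.
  by rewrite [M^T _ _]mxE zero// xpair_eqE (negbTE la).
rewrite addr0 !mxE /unit_env /sort_pair ab; ring.
Qed.

(** The index [i] occurs as first component once for each [j >= i] and as second once for each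
    [j <= i], in all [n + 1] times. *)
Let prod_diag (f : 'I_n -> R) :
  \prod_(k <- sym_pairs n) (f k.1 * f k.2) = (\prod_i f i) ^+ n.+1.
Proof.
rewrite /sym_pairs big_filter big_mkcond big_allpairs_dep big_enum /=.
under eq_bigr do rewrite big_enum -big_mkcond big_split /=.
rewrite big_split /= [X in _ * X](exchange_big_dep predT)//=.
rewrite -big_split /= -prodrXl; apply: eq_bigr => i _.
rewrite [X in _ * X](bigD1 i)//= mulrCA [X in _ * (_ * X)](eq_bigl (fun j : 'I_n => ~~ (i <= j)%N)).
  by rewrite -(bigID (fun j : 'I_n => (i <= j)%N) predT) /= prodr_const card_ord exprS.
by move=> j; rewrite -ltnNge ltn_neqAle andbC.
Qed.

Lemma emeas_congr (F : 'M[R]_n -> \bar R) : emeas (F \o @symmx R n) ->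
  emeas ((fun B => F (M *m B *m M^T)) \o @symmx R n).
Proof.
move=> mF; rewrite (_ : _ \o _ = (F \o @symmx R n) \o congr_env); last first.
  by apply/funext => e /=; rewrite symmx_congr.
move=> d T f mf; apply: (mF _ T (fun t => congr_env (f t))) => k.
rewrite /congr_env; case: (_ <= _)%N => //.
have mS := mmeas_symmx mf.
have mM (A : 'M[R]_n) : mmeas (fun _ : T => A) by move=> i j; exact: measurable_cst.
by apply: mmeas_mul => //; exact: mmeas_mul.
Qed.

(** Updating one coordinate adds a multiple of a symmetric unit matrix, so [congr_unit_env] yields
    both the diagonal coefficients and triangularity for the key [i + j]. *)
Lemma sym_integral_congr (F : 'M[R]_n -> \bar R) :
  emeas (F \o @symmx R n) -> (forall B, 0 <= F B)%E ->
  sym_integral (fun B => F (M *m B *m M^T)) =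
  ((\det M ^+ n.+1)^-1%:E * sym_integral F)%E.
Proof.
move=> mF F0; rewrite !sym_integralE.
have E : (fun B => F (M *m B *m M^T)) \o @symmx R n = (F \o @symmx R n) \o congr_env.
  by apply/funext => e /=; rewrite symmx_congr.
rewrite E [LHS](@iint_triangular R _ congr_env (fun k => M k.1 k.1 * M k.2 k.2)
  (fun k => k.1 + k.2)%N _ (F \o @symmx R n))//.
- congr (_%:E * _)%E.
    rewrite det_trig// -prod_diag -[RHS]prodfV; apply: eq_bigr => k _.
    by rewrite gtr0_norm ?mulr_gt0.
  apply: eq_iint => // k; rewrite mem_sym_pairs /congr_env => /negbTE ->.
  by [].
- by move=> e; exact: F0.
- exact: uniq_sym_pairs.
- by move=> k _; rewrite mulf_neq0// gt_eqF.
- move=> k; rewrite mem_sym_pairs => ks e.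
  exists (congr_env e k - M k.1 k.1 * M k.2 k.2 * e k) => x.
  rewrite /congr_env ks symmx_upd_unit mulmxDr mulmxDl [LHS]mxE.
  rewrite -scalemxAr -scalemxAl [X in _ + X]mxE congr_unit_env// eqxx mul1r; ring.
- move=> k; rewrite mem_sym_pairs => ks e x j jk; rewrite mem_sym_pairs /congr_env.
  case: leqP => [js /= key|_ _]; last by rewrite upd_neq.
  rewrite symmx_upd_unit mulmxDr mulmxDl [LHS]mxE.
  rewrite -scalemxAr -scalemxAl [X in _ + X]mxE congr_unit_env// (negbTE jk).
  by rewrite mul0r mulr0 addr0.
by rewrite -E; exact: emeas_congr.
Qed.

End Congruence.

(** * Cyclic invariance of traces of powers *)

Section TracePower.
Variables (R : realType) (n : nat).

Lemma mxpow_comm (X Y : 'M[R]_n) q :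
  mxpow (X *m Y) q *m X = X *m mxpow (Y *m X) q.
Proof.
elim: q => [|q ih]; first by rewrite mul1mx mulmx1.
have powS (A : 'M[R]_n) : mxpow A q.+1 = A *m mxpow A q by [].
by rewrite !powS -mulmxA ih !mulmxA.
Qed.

Lemma trace_mxpowC (X Y : 'M[R]_n) q :
  \tr (mxpow (X *m Y) q) = \tr (mxpow (Y *m X) q).
Proof.
case: q => [//|q].
have powS (A : 'M[R]_n) : mxpow A q.+1 = A *m mxpow A q by [].
rewrite !powS -[in LHS]mulmxA mxtrace_mulC.
by rewrite -(mulmxA Y (mxpow _ _) X) mxpow_comm mulmxA.
Qed.

Lemma invmx_congr (X Y B : 'M[R]_n) : X \in unitmx -> Y \in unitmx ->
  B \in unitmx -> invmx (invmx X *m B *m invmx Y) = Y *m invmx B *m X.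
Proof.
move=> uX uY uB; set A := _ *m _ *m invmx Y.
have uA : A \in unitmx by rewrite !unitmx_mul !unitmx_inv uX uY uB.
rewrite -[RHS](mulKmx uA); suff -> : A *m (Y *m invmx B *m X) = 1%:M by rewrite mulmx1.
by rewrite /A !mulmxA mulmxKV// mulmxK// mulVmx.
Qed.

End TracePower.

(** * The normalizing constant and the density *)

Section Density.
Variables (R : realType) (p : nat).

Definition integrand (a : R) (q : nat) (B : 'M[R]_p) : \bar R :=
  if `[< posdef B >] then
    (expR (- (1 / 2) * \tr (mxpow (invmx B) q)) * powR (\det B) (- a))%:E
  else 0%E.

Lemma integrand_ge0 a q B : (0 <= integrand a q B)%E.
Proof.
by rewrite /integrand; case: ifP => // _; rewrite lee_fin mulr_ge0 ?expR_ge0 ?powR_ge0.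
Qed.

Lemma emeas_integrand a q : emeas (integrand a q \o @symmx R p).
Proof.
apply: (@emeas_posdef_if R p (fun B =>
  expR (- (1 / 2) * \tr (mxpow (invmx B) q)) * powR (\det B) (- a))) => d T B mB sB.
have mpow b : measurable_fun setT (fun t => powR (\det (B t)) b).
  apply: (measurableT_comp (f := fun x => powR x b)); first exact: measurable_powR.
  exact: mmeas_det.
(* On the cone the inverse is the adjugate divided by the determinant; this form is measurable
   everywhere. *)
exists (fun t => expR (- (1 / 2) *
    \tr (mxpow (powR (\det (B t)) (-1) *: \adj (B t)) q)) * powR (\det (B t)) (- a)).
  apply: measurable_funM => //; apply: measurableT_comp; first exact: measurable_expR.
  apply: measurable_funM; first exact: measurable_cst.
  apply: measurable_sum => i.
  suff : mmeas (fun t => mxpow (powR (\det (B t)) (-1) *: \adj (B t)) q) by apply.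
  elim: q => [|q ih]; first by move=> ? ?; exact: measurable_cst.
  apply: mmeas_mul ih => k l; under eq_fun do rewrite mxE.
  by apply: measurable_funM => //; exact: mmeas_adj.
move=> t pB; rewrite /invmx posdef_unit// powR_inv1//.
exact/ltW/posdef_det_gt0.
Qed.

Lemma c_constE (m : R) q : c_const p m q =
  sym_integral (integrand (q%:R * m / 2 + p%:R / 2 + 1 / 2) q).
Proof.
rewrite /c_const; congr sym_integral; apply/funext => B; rewrite /integrand.
by rewrite !opprD.
Qed.

Lemma integral_integrand_fin (a : R) q : (0 < q)%N -> p%:R + 1 / 2 <= a ->
  (sym_integral (integrand a q) < +oo)%E.
Proof.
move=> q0 pa; rewrite sym_integralE.
have [K K0 KP] := @integrand_bound R p q a q0.
have mc := @emeas_cone_integrand R p a.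
have c0 := @cone_integrand_ge0 R p a.
apply: (@le_lt_trans _ _ (iint (sym_pairs p)
    (fun e => K%:E * cone_integrand a e)%E (fun=> 0))).
  apply: iint_le.
  - exact: emeas_integrand.
  - by move=> d T f mf; apply: emeasurable_funM => //; exact: mc.
  - by move=> e; exact: integrand_ge0.
  move=> e; rewrite /= /integrand /cone_integrand.
  by case: asboolP => [pB|_]; rewrite ?mule0// -EFinM lee_fin KP.
rewrite iint_scale ?(ltW K0)//; apply: lte_mul_pinfty => //.
  by rewrite lee_fin ltW.
exact: cone_integral_fin.
Qed.

Lemma integral_integrand_gt0 (a : R) q : (0 < p)%N ->
  (0 < sym_integral (integrand a q))%E.
Proof.
move=> p0; rewrite sym_integralE.
have r0 : 0 < (2 * p%:R)^-1 :> R by rewrite invr_gt0 mulr_gt0 ?ltr0n.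
apply: (@iint_gt0 R _ _ _ (fun k => (k.1 == k.2)%:R) _ _ _ _ r0).
- exact: emeas_integrand.
- by move=> e; exact: integrand_ge0.
- move=> e eP /=; have pB := posdef_near_id p0 eP.
  rewrite /integrand; case: asboolP => // _.
  by rewrite lte_fin mulr_gt0 ?expR_gt0 ?powR_gt0 ?posdef_det_gt0.
(* Coordinates below the diagonal keep their initial value 0, which is the centre of the cube
   there. *)
move=> k; rewrite mem_sym_pairs -ltnNge => k12.
by rewrite (_ : k.1 == k.2 = false) ?subrr ?normr0// gt_eqF.
Qed.

(** With [S] the square root, [S B^(-1) S] and [L^T B^(-1) L] have the same traces of powers,
    because [S S = Psi = L L^T]. The congruence contributes [det(Psi)^a], and [qm/2] is [a] less
    [(p + 1)/2]. *)
Lemma piw_density_integrand (Psi L : 'M[R]_p) (m : R) (q : nat) (B : 'M[R]_p) :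
  posdef Psi -> is_trig_mx L -> (forall i, 0 < L i i) -> Psi = L *m L^T ->
  (if `[< posdef B >] then (piw_density Psi m q B)%:E else 0%E) =
  (((fine (c_const p m q))^-1 * powR (\det Psi) (- (p%:R / 2 + 1 / 2)))%:E *
   integrand (q%:R * m / 2 + p%:R / 2 + 1 / 2) q
     (invmx L *m B *m (invmx L)^T))%E.
Proof.
move=> pPsi tL L0 PsiE; have dL0 := trig_det_gt0 tL L0.
have uL : L \in unitmx by rewrite unitmxE unitfE gt_eqF.
have uLi : invmx L \in unitmx by rewrite unitmx_inv.
rewrite /integrand (asbool_equiv_eq (posdef_congrE B uLi)).
case: asboolP => [pB|_]; last by rewrite mule0.
rewrite -EFinM; congr (_%:E); rewrite /piw_density.
set c := (fine _)^-1; set a := q%:R * m / 2 + p%:R / 2 + 1 / 2.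
have [pS SS] := mx_sqrtP pPsi.
have uB := posdef_unit pB; have uS := posdef_unit pS.
have uLT : L^T \in unitmx by rewrite unitmx_tr.
have -> : \tr (mxpow (invmx (mx_isqrt Psi *m B *m mx_isqrt Psi)) q) =
    \tr (mxpow (invmx (invmx L *m B *m (invmx L)^T)) q).
  rewrite trmx_inv !invmx_congr// -!mulmxA trace_mxpowC -mulmxA SS.
  by rewrite [RHS]trace_mxpowC -mulmxA -PsiE.
have dPsi := posdef_det_gt0 pPsi; have dB := posdef_det_gt0 pB.
have -> : \det (invmx L *m B *m (invmx L)^T) = \det B * (\det Psi)^-1.
  rewrite !det_mulmx det_tr det_inv PsiE det_mulmx det_tr invfM; ring.
rewrite powRM ?invr_ge0 ?ltW// -(powR_inv1 (ltW dPsi)) -powRrM mulN1r opprK.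
rewrite -powRN -/a -(_ : powR (\det Psi) (- (p%:R / 2 + 1 / 2)) * powR (\det Psi) a =
  powR (\det Psi) (q%:R * m / 2)); first by ring.
rewrite -powRD ?(gt_eqF dPsi) ?implybT//; congr (powR _ _); rewrite /a; ring.
Qed.

End Density.

Theorem theorem1 (R : realType) (p : nat) (Psi : 'M[R]_p) (m : R) (q : nat) :
  (0 < p)%N -> posdef Psi -> p%:R <= m -> (0 < q)%N ->
  ((0 < c_const p m q)%E /\ (c_const p m q < +oo)%E) /\
  (forall B : 'M[R]_p, posdef B -> 0 <= piw_density Psi m q B) /\
  sym_integral (fun B : 'M[R]_p =>
    if `[< posdef B >] then (piw_density Psi m q B)%:E else 0%E) = 1%E.
Proof.
move=> p0 pPsi pm q0.
have c0 : (0 < c_const p m q)%E by rewrite c_constE integral_integrand_gt0.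
have cy : (c_const p m q < +oo)%E.
  (* The condition [p + 1/2 <= a] reduces to [q m >= p], which follows from [q m >= m >= p]. *)
  rewrite c_constE integral_integrand_fin// lerD2r.
  have : 1 <= q%:R :> R by rewrite ler1n.
  have m0 : 0 <= m by rewrite (le_trans _ pm).
  by move=> /(ler_wpM2r m0); rewrite mul1r; lra.
have fc0 : 0 < fine (c_const p m q) by rewrite fine_gt0// c0.
split=> //; split=> [B _|].
  by rewrite /piw_density !mulr_ge0 ?invr_ge0 ?expR_ge0 ?powR_ge0// ltW.
have [L [tL L0 PsiE]] := cholesky pPsi.
have [tLi Lid] := trig_invmx tL L0.
have dL0 := trig_det_gt0 tL L0.
have dPsi := posdef_det_gt0 pPsi.
under [X in sym_integral X]eq_fun do rewrite (piw_density_integrand m q _ pPsi tL L0 PsiE).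
set a := q%:R * m / 2 + p%:R / 2 + 1 / 2; set k := _ * _.
have k0 : 0 <= k by rewrite mulr_ge0 ?invr_ge0 ?powR_ge0// ltW.
have mI : emeas ((fun B => integrand a q (invmx L *m B *m (invmx L)^T)) \o @symmx R p).
  exact/emeas_congr/emeas_integrand.
have I0 B : (0 <= integrand a q (invmx L *m B *m (invmx L)^T))%E.
  exact: integrand_ge0.
rewrite sym_integralE [LHS](iint_scale _ _ mI (fun e => I0 (symmx e)) k0).
rewrite -(sym_integralE (fun B => integrand a q (invmx L *m B *m (invmx L)^T))).
rewrite (sym_integral_congr tLi _ (@emeas_integrand R p a q) (@integrand_ge0 R p a q)); last first.
  by move=> i; rewrite Lid invr_gt0.
rewrite -c_constE -[c_const p m q]fineK ?ge0_fin_numE ?ltW//.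
rewrite -!EFinM; congr (_%:E); rewrite /k.
(* Since [det(L)^2 = det(Psi)], the Jacobian factor is [det(Psi)^((p+1)/2)], which cancels the power
   of [det(Psi)] in the prefactor [k]. *)
have -> : (\det (invmx L) ^+ p.+1)^-1 = powR (\det Psi) (p%:R / 2 + 1 / 2).
  rewrite det_inv exprVn invrK PsiE det_mulmx det_tr -expr2 -powR_mulrn ?ltW//.
  rewrite -powR_mulrn ?ltW// -powRrM; congr (powR _ _).
  by rewrite -natr1; field.
rewrite powRN; field.
by rewrite !gt_eqF ?powR_gt0.
Qed.
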